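(* Let $t,n\in\mathbb N$, $m\in\mathbb Z_+$, $t<n$, and $\lambda\vdash t$, and let $\mathbb Z$ be the trivial $\mathbb ZS_{n-t}$-module. Then the $\mathbb ZS_n$-module $$\bigl(S(\lambda)/mS(\lambda)\bigr)\uparrow S_n:=\mathbb ZS_n\otimes_{\mathbb Z(S_t\times S_{n-t})}\Bigl(\bigl(S(\lambda)/mS(\lambda)\bigr)\otimes_{\mathbb Z}\mathbb Z\Bigr)$$ has a series of submodules with factors $S(\nu)/mS(\nu)$, where $\nu$ runs over the set of all partitions $\nu\vdash n$ such that $$\lambda_n\leqslant\nu_n\leqslant\lambda_{n-1}\leqslant\nu_{n-1}\leqslant\dots\leqslant\lambda_2\leqslant\nu_2\leqslant\lambda_1\leqslant\nu_1,$$ and each factor occurs exactly once.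
   Context: $\mathbb N=\{1,2,\dots\}$, $\mathbb Z_+=\{0,1,2,\dots\}$. $\lambda\vdash n$ means $\lambda=(\lambda_1,\dots,\lambda_s)$ with integers $\lambda_1\geqslant\dots\geqslant\lambda_s>0$, $\sum\lambda_i=n$; put $\lambda_i=0$ for $i>s$. For a Young tableau $T_\lambda$ of shape $\lambda\vdash n$ (boxes filled bijectively with $1,\dots,n$) with row stabilizer $R_{T_\lambda}$ and column stabilizer $C_{T_\lambda}$ in $S_n$, let $a_{T_\lambda}=\sum_{\pi\in R_{T_\lambda}}\pi$ and $b_{T_\lambda}=\sum_{\sigma\in C_{T_\lambda}}(\operatorname{sign}\sigma)\sigma$. The (integral) Specht module is $S(\lambda):=(\mathbb ZS_n)b_{T_\lambda}a_{T_\lambda}$; up to isomorphism it does not depend on the choice of $T_\lambda$. $S_t\times S_{n-t}\subseteq S_n$ is the standard Young subgroup. *)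

(* Defs.v *)
From HB Require Import structures.
From mathcomp Require Import all_boot all_order all_algebra all_fingroup.
From mathcomp Require Import generic_quotient boolp freeg.

Set Implicit Arguments.
Unset Strict Implicit.
Unset Printing Implicit Defensive.

Import GRing.Theory.

Local Open Scope ring_scope.
Local Open Scope quotient_scope.

Section Submodule.
Variables (R : pzRingType) (V : lmodType R) (U : submodClosed V).

Record submod := Submod { submod_val : V; submodP : submod_val \in U }.

HB.instance Definition _ := [isSub for submod_val].
HB.instance Definition _ := [Choice of submod by <:].
HB.instance Definition _ := [SubChoice_isSubLmodule of submod by <:].
End Submodule.

Section QuotientModule.
Variables (R : pzRingType) (V : lmodType R) (U : submodClosed V).

(* A submodClosed is not canonically a zmodClosed, as Quotient.quot requires. *)
Definition quotmod_kernel : {pred V} := fun x => x \in U.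

Fact quotmod_kernel_closed : zmod_closed quotmod_kernel.
Proof. exact: GRing.submod_closedB (submodClosedP U). Qed.
HB.instance Definition _ :=
  GRing.isZmodClosed.Build V quotmod_kernel quotmod_kernel_closed.

Definition quotmod : Type := Quotient.quot quotmod_kernel.

HB.instance Definition _ := GRing.Zmodule.on quotmod.
HB.instance Definition _ := EqQuotient.on quotmod.

Lemma quotmod_eqP (x y : V) :
  reflect (\pi_quotmod x = \pi_quotmod y) (x - y \in U).
Proof. by rewrite -[_ \in U]/(_ \in quotmod_kernel) Quotient.idealrBE; exact: eqP. Qed.

Lemma quotmod_piD (x y : V) :
  \pi_quotmod (x + y) = \pi_quotmod x + \pi_quotmod y.
Proof. exact: (@pi_addr _ _ _ _ _ (Quotient.quot quotmod_kernel)). Qed.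

Definition quotmod_scale (a : R) (x : quotmod) : quotmod :=
  \pi_quotmod (a *: repr x).

Lemma quotmod_piZ a (x : V) :
  quotmod_scale a (\pi_quotmod x) = \pi_quotmod (a *: x).
Proof.
apply/quotmod_eqP; rewrite -scalerBr; apply: rpredZ.
by apply/quotmod_eqP; rewrite reprK.
Qed.

Fact quotmod_scalerA a b x :
  quotmod_scale a (quotmod_scale b x) = quotmod_scale (a * b) x.
Proof. by elim/quotW: x => x; rewrite (quotmod_piZ b) !quotmod_piZ scalerA. Qed.
Fact quotmod_scale1r : left_id 1 quotmod_scale.
Proof. by elim/quotW => x; rewrite quotmod_piZ scale1r. Qed.
Fact quotmod_scalerDr : right_distributive quotmod_scale +%R.
Proof.
move=> a; elim/quotW => x; elim/quotW => y.
by rewrite -quotmod_piD !quotmod_piZ -quotmod_piD scalerDr.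
Qed.
Fact quotmod_scalerDl x :
  {morph quotmod_scale^~ x : a b / a + b}.
Proof.
by move=> a b; elim/quotW: x => x; rewrite !quotmod_piZ -quotmod_piD scalerDl.
Qed.

HB.instance Definition _ := GRing.Zmodule_isLmodule.Build R quotmod
  quotmod_scalerA quotmod_scale1r quotmod_scalerDr quotmod_scalerDl.
End QuotientModule.

Section Multiples.
Variables (R : pzRingType) (V : lmodType R) (m : nat).

Definition multiples : {pred V} := fun x => `[< exists y, x = y *+ m >].

Fact multiples_closed : submod_closed multiples.
Proof.
split=> [|a x y /asboolP[x' ->] /asboolP[y' ->]]; apply/asboolP.
  by exists 0; rewrite mul0rn.
by exists (a *: x' + y'); rewrite mulrnDl scalerMnr.
Qed.
HB.instance Definition _ :=
  GRing.isSubmodClosed.Build R V multiples multiples_closed.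
End Multiples.

Definition mod_mult (R : pzRingType) (V : lmodType R) (m : nat) : lmodType R :=
  quotmod (@multiples R V m).

Section Subquotient.
Variables (R : pzRingType) (V : lmodType R) (U W : submodClosed V).

Definition restr_pred : {pred submod W} := fun x => submod_val x \in U.

Fact restr_pred_closed : submod_closed restr_pred.
Proof.
split=> [|a x y xU yU]; first exact: (rpred0 U).
by apply: (rpredD (S := U)) => //; apply: rpredZ.
Qed.
HB.instance Definition _ :=
  GRing.isSubmodClosed.Build R (submod W) restr_pred restr_pred_closed.

(* W / (U :&: W), that is, W / U when U is contained in W. *)
Definition subquotient : lmodType R := quotmod restr_pred.
End Subquotient.

Definition isomorphic (R : pzRingType) (V W : lmodType R) : Prop :=
  exists f : {linear V -> W}, bijective f.

Definition has_series (R : pzRingType) (V : lmodType R)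
    (factors : seq (lmodType R)) : Prop :=
  exists U : nat -> submodClosed V,
    [/\ forall x, x \in U 0%N <-> x = 0,
        forall x, x \in U (size factors) &
        forall i, (i < size factors)%N ->
          {subset U i <= U i.+1} /\
          isomorphic (subquotient (U i) (U i.+1)) (nth V factors i)].

(* The abelian group presented by generators a (x) b subject to biadditivity  *)
(* and (a . s) (x) b = a (x) (s . b), for arbitrary operations of S on A (on  *)
(* the right) and on B (on the left).                                         *)
Section Tensor.
Variables (A B : zmodType) (S : Type) (ra : A -> S -> A) (la : S -> B -> B).

Local Notation F := {freeg (A * B) / int}.
Local Notation gen a b := ([freeg [:: (1 : int, (a, b))]] : F).

Inductive tensor_relator : F -> Prop :=
  | TensorDl a a' b :
      tensor_relator (gen (a + a') b - (gen a b + gen a' b))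
  | TensorDr a b b' :
      tensor_relator (gen a (b + b') - (gen a b + gen a b'))
  | TensorBalanced a s b :
      tensor_relator (gen (ra a s) b - gen a (la s b)).

Definition tensor_kernel : {pred F} := fun x =>
  `[< forall P : {pred F}, zmod_closed P ->
        (forall r, tensor_relator r -> r \in P) -> x \in P >].

Fact tensor_kernel_closed : zmod_closed tensor_kernel.
Proof.
split=> [|x y /asboolP xK /asboolP yK]; apply/asboolP => P Pz Pr.
  by case: Pz.
by case: (Pz) => _; apply; [apply: xK | apply: yK].
Qed.
HB.instance Definition _ :=
  GRing.isZmodClosed.Build F tensor_kernel tensor_kernel_closed.

Definition tensor : Type := Quotient.quot tensor_kernel.
HB.instance Definition _ := GRing.Zmodule.on tensor.
HB.instance Definition _ := EqQuotient.on tensor.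

Definition tens (a : A) (b : B) : tensor := \pi_tensor (gen a b).

Lemma tensor_eqP (x y : F) :
  reflect (\pi_tensor x = \pi_tensor y) (x - y \in tensor_kernel).
Proof. by rewrite (Quotient.idealrBE tensor_kernel); exact: eqP. Qed.

Lemma tensor_piD (x y : F) :
  \pi_tensor (x + y) = \pi_tensor x + \pi_tensor y.
Proof. exact: (@pi_addr _ _ _ _ _ (Quotient.quot tensor_kernel)). Qed.

Lemma tensor_pi0 : \pi_tensor 0 = 0.
Proof. exact: (@pi_zeror _ _ _ _ _ (Quotient.quot tensor_kernel)). Qed.

Lemma tensor_piN (x : F) : \pi_tensor (- x) = - \pi_tensor x.
Proof. exact: (@pi_oppr _ _ _ _ _ (Quotient.quot tensor_kernel)). Qed.

Lemma tensor_relatorP r : tensor_relator r -> r \in tensor_kernel.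
Proof. by move=> rP; apply/asboolP => P _; apply. Qed.

Lemma tensDl a a' b : tens (a + a') b = tens a b + tens a' b.
Proof.
by rewrite /tens -tensor_piD; apply/tensor_eqP/tensor_relatorP/TensorDl.
Qed.
Lemma tensDr a b b' : tens a (b + b') = tens a b + tens a b'.
Proof.
by rewrite /tens -tensor_piD; apply/tensor_eqP/tensor_relatorP/TensorDr.
Qed.
Lemma tens_balanced a s b : tens (ra a s) b = tens a (la s b).
Proof. by apply/tensor_eqP/tensor_relatorP/TensorBalanced. Qed.

Lemma tensor_eq (V : zmodType) (f g : tensor -> V) :
    {morph f : x y / x + y} -> {morph g : x y / x + y} ->
  (forall a b, f (tens a b) = g (tens a b)) -> f =1 g.
Proof.
move=> fD gD fg.
have f0 : f 0 = 0 by apply: (addrI (f 0)); rewrite -fD !addr0.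
have g0 : g 0 = 0 by apply: (addrI (g 0)); rewrite -gD !addr0.
have fN x : f (- x) = - f x.
  by apply: (addrI (f x)); rewrite -fD !subrr.
have gN x : g (- x) = - g x.
  by apply: (addrI (g x)); rewrite -gD !subrr.
have fg1 k a b : f (\pi_tensor [freeg [:: (k : int, (a, b))]])
               = g (\pi_tensor [freeg [:: (k, (a, b))]]).
  have Pn n : f (\pi_tensor [freeg [:: (n%:Z, (a, b))]])
            = g (\pi_tensor [freeg [:: (n%:Z, (a, b))]]).
    elim: n => [|n IHn]; first by rewrite freegU0 tensor_pi0 f0 g0.
    rewrite -addn1 PoszD -freegUD tensor_piD fD gD IHn; congr (_ + _).
    exact: fg.
  case: k => n; first exact: Pn.
  by rewrite NegzE -freegUN tensor_piN fN gN Pn.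
elim/quotW => x; rewrite -(freeg_sumE x).
elim: (dom x) => [|[a b] r IHr]; first by rewrite big_nil tensor_pi0 f0 g0.
by rewrite big_cons tensor_piD fD gD fg1 IHr.
Qed.

Definition free_lift (V : zmodType) (f : A -> B -> V) : F -> V :=
  fglift ((fun ab => f ab.1 ab.2) : (A * B)%type -> zmodule V).

Section FreeLift.
Variables (V : zmodType) (f : A -> B -> V).

Lemma free_liftB x y : free_lift f (x - y) = free_lift f x - free_lift f y.
Proof. exact: (lift_is_additive ((fun ab => f ab.1 ab.2) : _ -> zmodule V)). Qed.
Lemma free_lift0 : free_lift f 0 = 0.
Proof. by rewrite -[X in free_lift f X](subrr 0) free_liftB subrr. Qed.
Lemma free_liftD x y : free_lift f (x + y) = free_lift f x + free_lift f y.
Proof.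
by rewrite -[in LHS](opprK y) free_liftB -(sub0r y) free_liftB free_lift0 sub0r
  opprK.
Qed.
Lemma free_liftE a b : free_lift f (gen a b) = f a b.
Proof. by rewrite /free_lift liftU scale1r. Qed.
End FreeLift.

Definition tensor_lift (V : zmodType) (f : A -> B -> V) (x : tensor) : V :=
  free_lift f (repr x).

Section Lift.
Variables (V : zmodType) (f : A -> B -> V).
Hypothesis fDl : forall a a' b, f (a + a') b = f a b + f a' b.
Hypothesis fDr : forall a b b', f a (b + b') = f a b + f a b'.
Hypothesis f_balanced : forall a s b, f (ra a s) b = f a (la s b).

Lemma tensor_lift_pi (x : F) : tensor_lift f (\pi_tensor x) = free_lift f x.
Proof.
apply/eqP; rewrite -subr_eq0 -free_liftB.
have /asboolP : repr (\pi_tensor x) - x \in tensor_kernel.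
  by apply/tensor_eqP; rewrite reprK.
move=> /(_ (fun y => free_lift f y == 0)); apply.
  split=> [|y z]; rewrite !unfold_in; first by rewrite free_lift0.
  by move=> /eqP y0 /eqP z0; rewrite free_liftB y0 z0 subrr.
move=> r []*; rewrite unfold_in free_liftB ?free_liftD !free_liftE; apply/eqP.
- by rewrite fDl subrr.
- by rewrite fDr subrr.
- by rewrite f_balanced subrr.
Qed.

Lemma tensor_liftD : {morph tensor_lift f : x y / x + y}.
Proof.
elim/quotW => x; elim/quotW => y.
by rewrite -tensor_piD !tensor_lift_pi free_liftD.
Qed.

Lemma tensor_liftE a b : tensor_lift f (tens a b) = f a b.
Proof. by rewrite tensor_lift_pi free_liftE. Qed.
End Lift.

Definition tensor_map (f : A -> A) (g : B -> B) : tensor -> tensor :=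
  tensor_lift (fun a b => tens (f a) (g b)).

Section Map.
Variables (f : A -> A) (g : B -> B).
Hypotheses (fD : {morph f : x y / x + y}) (gD : {morph g : x y / x + y}).
Hypothesis f_lin : forall a s, f (ra a s) = ra (f a) s.
Hypothesis g_lin : forall s b, g (la s b) = la s (g b).

Lemma tensor_mapD : {morph tensor_map f g : x y / x + y}.
Proof.
by apply: tensor_liftD => *;
  rewrite ?fD ?gD ?tensDl ?tensDr ?f_lin ?g_lin ?tens_balanced.
Qed.
Lemma tensor_mapE a b : tensor_map f g (tens a b) = tens (f a) (g b).
Proof.
by rewrite /tensor_map tensor_liftE => *;
  rewrite ?fD ?gD ?tensDl ?tensDr ?f_lin ?g_lin ?tens_balanced.
Qed.
End Map.
End Tensor.

Section GroupRing.
Variable gT : finGroupType.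

Definition group_ring : Type := {ffun gT -> int}.
HB.instance Definition _ := GRing.Zmodule.on group_ring.

Implicit Types x y z : group_ring.

Definition gr_elt (g : gT) : group_ring := [ffun h => (h == g)%:R].
Definition gr_mul x y : group_ring :=
  [ffun g => \sum_h x h * y (h^-1 * g)%g].

Lemma gr_addE x y g : (x + y : group_ring) g = x g + y g.
Proof. by rewrite ffunE. Qed.

Fact gr_mulA : associative gr_mul.
Proof.
move=> x y z; apply/ffunP => g; rewrite !ffunE.
under eq_bigr do rewrite ffunE mulr_sumr.
under [RHS]eq_bigr do rewrite ffunE mulr_suml.
rewrite [RHS]exchange_big; apply: eq_bigr => h _ /=.
rewrite [RHS](reindex_inj (mulgI h)); apply: eq_bigr => k _ /=.
by rewrite mulKg mulrA invMg mulgA.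
Qed.
Fact gr_mul1 : left_id (gr_elt 1) gr_mul.
Proof.
move=> x; apply/ffunP => g; rewrite ffunE (bigD1 1%g) //= ffunE eqxx mul1r.
rewrite invg1 mul1g big1 ?addr0 // => h /negPf h1.
by rewrite ffunE h1 mul0r.
Qed.
Fact gr_mulr1 : right_id (gr_elt 1) gr_mul.
Proof.
move=> x; apply/ffunP => g; rewrite ffunE (bigD1 g) //= ffunE mulVg eqxx.
rewrite mulr1 big1 ?addr0 // => h /negPf hg.
by rewrite ffunE -eq_mulVg1 hg mulr0.
Qed.
Fact gr_mulDl : left_distributive gr_mul +%R.
Proof.
move=> x y z; apply/ffunP => g; rewrite !ffunE -big_split.
by apply: eq_bigr => h _; rewrite ffunE mulrDl.
Qed.
Fact gr_mulDr : right_distributive gr_mul +%R.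
Proof.
move=> x y z; apply/ffunP => g; rewrite !ffunE -big_split.
by apply: eq_bigr => h _; rewrite ffunE mulrDr.
Qed.
Fact gr_oner_neq0 : gr_elt 1 != 0.
Proof. by apply/eqP => /ffunP/(_ 1%g); rewrite !ffunE eqxx. Qed.

HB.instance Definition _ := GRing.Zmodule_isNzRing.Build group_ring
  gr_mulA gr_mul1 gr_mulr1 gr_mulDl gr_mulDr gr_oner_neq0.

Lemma gr_mulE x y g : (x * y) g = \sum_h x h * y (h^-1 * g)%g.
Proof. by rewrite ffunE. Qed.

Lemma gr_eltM g h : gr_elt (g * h)%g = gr_elt g * gr_elt h.
Proof.
apply/ffunP => k; rewrite gr_mulE (bigD1 g) //= !ffunE eqxx mul1r.
rewrite big1 ?addr0 => [|l /negPf lg]; last by rewrite !ffunE lg mul0r.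
by rewrite (canF_eq (mulKVg g)).
Qed.

(* The linear extension to the group ring of an action of the group. *)
Definition gr_scale (V : zmodType) (act : gT -> V -> V) x (v : V) : V :=
  \sum_g act g v *~ x g.

Section Scale.
Variables (V : zmodType) (act : gT -> V -> V).
Hypothesis actD : forall g, {morph act g : u v / u + v}.
Hypothesis act1 : forall v, act 1%g v = v.
Hypothesis actM : forall g h v, act (g * h)%g v = act g (act h v).

Local Notation scale := (gr_scale act).

Let act0 g : act g 0 = 0.
Proof. by apply: (addrI (act g 0)); rewrite -actD !addr0. Qed.
Let actN g v : act g (- v) = - act g v.
Proof. by apply: (addrI (act g v)); rewrite -actD !subrr. Qed.
Let actMn g v n : act g (v *+ n) = act g v *+ n.
Proof. by elim: n => [|n IHn]; rewrite ?mulr0n // !mulrS actD IHn. Qed.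
Let actMz g v (k : int) : act g (v *~ k) = act g v *~ k.
Proof.
by case: k => n; rewrite ?NegzE ?mulrNz -?pmulrn ?actN actMn.
Qed.

Lemma gr_scalerA x y v : scale x (scale y v) = scale (x * y) v.
Proof.
rewrite /gr_scale.
under [RHS]eq_bigr do rewrite gr_mulE mulrz_sumr.
rewrite [RHS]exchange_big; apply: eq_bigr => g _ /=.
rewrite [RHS](reindex_inj (mulgI g)) /=.
rewrite (big_morph (act g) (actD g) (act0 g)) mulrz_suml.
by apply: eq_bigr => h _; rewrite actMz actM mulKg mulrC mulrzA.
Qed.
Lemma gr_scale1r : left_id 1 scale.
Proof.
move=> v; rewrite /gr_scale (bigD1 1%g) //= ffunE eqxx act1 big1 ?addr0 //.
by move=> g /negPf g1; rewrite ffunE g1.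
Qed.
Lemma gr_scalerDr : right_distributive scale +%R.
Proof.
move=> x u v; rewrite /gr_scale -big_split; apply: eq_bigr => g _.
by rewrite actD mulrzDl.
Qed.
Lemma gr_scalerDl v : {morph scale^~ v : x y / x + y}.
Proof.
move=> x y; rewrite /gr_scale -big_split; apply: eq_bigr => g _.
by rewrite ffunE mulrzDr.
Qed.
End Scale.

End GroupRing.

Definition trivial_module (gT : finGroupType) : Type := int.

Section TrivialModule.
Variable gT : finGroupType.
HB.instance Definition _ := GRing.Zmodule.on (trivial_module gT).

Let triv_act (g : gT) (k : trivial_module gT) : trivial_module gT := k.

HB.instance Definition _ :=
  GRing.Zmodule_isLmodule.Build (group_ring gT) (trivial_module gT)
    (@gr_scalerA _ _ triv_act (fun _ _ _ => erefl) (fun _ _ _ => erefl))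
    (@gr_scale1r _ _ triv_act (fun=> erefl))
    (@gr_scalerDr _ _ triv_act (fun _ _ _ => erefl))
    (@gr_scalerDl _ _ triv_act).
End TrivialModule.

Section OuterTensor.
Variables (gT hT : finGroupType).
Variables (M : lmodType (group_ring gT)) (N : lmodType (group_ring hT)).

Definition outer_tensor : Type :=
  tensor (fun (u : M) (k : int) => u *~ k) (fun (k : int) (v : N) => v *~ k).
HB.instance Definition _ := GRing.Zmodule.on outer_tensor.

Definition outer_act (p : gT * hT) : outer_tensor -> outer_tensor :=
  tensor_map (fun u => gr_elt p.1 *: u) (fun v => gr_elt p.2 *: v).

Let actZl (R : pzRingType) (V : lmodType R) (a : R) (u : V) (k : int) :
  a *: (u *~ k) = (a *: u) *~ k.
Proof. exact: (raddfMz ( *:%R a)). Qed.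

Lemma outer_actE p u v :
  outer_act p (tens _ _ u v) = tens _ _ (gr_elt p.1 *: u) (gr_elt p.2 *: v).
Proof.
by apply: tensor_mapE => [??|??|??|??]; rewrite ?scalerDr ?actZl.
Qed.
Fact outer_actD p : {morph outer_act p : x y / x + y}.
Proof.
by apply: tensor_mapD => [??|??|??|??]; rewrite ?scalerDr ?actZl.
Qed.
Fact outer_act1 x : outer_act 1%g x = x.
Proof.
move: x; apply: (tensor_eq (g := id)) => // [|u v]; first exact: outer_actD.
by rewrite outer_actE !scale1r.
Qed.
Fact outer_actM p q x : outer_act (p * q)%g x = outer_act p (outer_act q x).
Proof.
move: x; apply: (tensor_eq (g := outer_act p \o outer_act q)) => [|x y|u v] /=.
- exact: outer_actD.
- by rewrite !outer_actD.
- by rewrite !outer_actE !gr_eltM !scalerA.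
Qed.

HB.instance Definition _ :=
  GRing.Zmodule_isLmodule.Build (group_ring (gT * hT)%type) outer_tensor
    (gr_scalerA outer_actD outer_actM) (gr_scale1r outer_act1)
    (gr_scalerDr outer_actD) (@gr_scalerDl _ _ outer_act).
End OuterTensor.

Section Induction.
Variables (hT gT : finGroupType) (e : hT -> gT).

Definition gr_map (r : group_ring hT) : group_ring gT :=
  \sum_h gr_elt (e h) *~ r h.

Variable M : lmodType (group_ring hT).

Definition induced : Type :=
  tensor (fun (x : group_ring gT) (r : group_ring hT) => x * gr_map r)
         (fun (r : group_ring hT) (v : M) => r *: v).
HB.instance Definition _ := GRing.Zmodule.on induced.

Definition induced_scale (y : group_ring gT) : induced -> induced :=
  tensor_map (fun x => y * x) id.

Lemma induced_scaleE y x v :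
  induced_scale y (tens _ _ x v) = tens _ _ (y * x) v.
Proof.
by apply: tensor_mapE => [??|??|??|??] //; rewrite ?mulrDr ?mulrA.
Qed.
Fact induced_scalerDr : right_distributive induced_scale +%R.
Proof.
by move=> y; apply: tensor_mapD => [??|??|??|??] //; rewrite ?mulrDr ?mulrA.
Qed.
Fact induced_scalerA y z v :
  induced_scale y (induced_scale z v) = induced_scale (y * z) v.
Proof.
move: v; apply: (tensor_eq (f := induced_scale y \o induced_scale z)).
- by move=> u v /=; rewrite !induced_scalerDr.
- exact: induced_scalerDr.
- by move=> x v /=; rewrite !induced_scaleE mulrA.
Qed.
Fact induced_scale1r : left_id 1 induced_scale.
Proof.
apply: (tensor_eq (g := id)) => // [|x v]; first exact: induced_scalerDr.
by rewrite induced_scaleE mul1r.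
Qed.
Fact induced_scalerDl v : {morph induced_scale^~ v : y z / y + z}.
Proof.
move=> y z; move: v.
apply: (tensor_eq (g := fun v => induced_scale y v + induced_scale z v)).
- exact: induced_scalerDr.
- by move=> u v; rewrite !induced_scalerDr addrACA.
- by move=> x v; rewrite !induced_scaleE mulrDl tensDl.
Qed.

HB.instance Definition _ :=
  GRing.Zmodule_isLmodule.Build (group_ring gT) induced
    induced_scalerA induced_scale1r induced_scalerDr induced_scalerDl.
End Induction.

Section YoungSubgroup.
Variables t n : nat.

Definition young_fun k (p : 'S_t * 'S_k) (i : 'I_(t + k)) : 'I_(t + k) :=
  match split i with
  | inl j => lshift k (p.1 j)
  | inr j => rshift t (p.2 j)
  end.

Fact young_fun_inj k (p : 'S_t * 'S_k) : injective (young_fun p).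
Proof.
apply: (can_inj (g := young_fun (p^-1)%g)) => i; rewrite /young_fun.
case: (split_ordP i) => j ->.
  by rewrite (unsplitK (inl _)) permK.
by rewrite (unsplitK (inr _)) permK.
Qed.

Definition young_perm (le_tn : (t <= n)%N) (p : 'S_t * 'S_(n - t)) : 'S_n :=
  cast_perm (subnKC le_tn) (perm (@young_fun_inj _ p)).

Lemma young_permM le_tn : {morph young_perm le_tn : p q / (p * q)%g}.
Proof.
move=> p q; apply/permP => i; rewrite permM /young_perm !cast_permE.
rewrite cast_ordK !permE; congr cast_ord; rewrite /young_fun.
case: (split_ordP (cast_ord _ i)) => j _.
  by rewrite (unsplitK (inl _)) permM.
by rewrite (unsplitK (inr _)) permM.
Qed.
End YoungSubgroup.

Definition is_partition (n : nat) (la : seq nat) : bool :=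
  [&& sorted geq la, 0%N \notin la & sumn la == n].

Record intpart (n : nat) :=
  IntPart { parts :> seq nat; _ : is_partition n parts }.
HB.instance Definition _ n := [isSub for @parts n].
HB.instance Definition _ n := [Equality of intpart n by <:].

(* The i-th part in 0-based indexing, hence lambda_(i+1). *)
Definition part n (la : intpart n) (i : nat) : nat := nth 0%N la i.

Section Tableau.
Variables (n : nat) (la : intpart n).

Definition box : finType := {i : 'I_(size la) & 'I_(part la i)}.
Definition row_of (b : box) : nat := tag b.
Definition col_of (b : box) : nat := tagged b.

Record tableau := Tableau { fill :> box -> 'I_n; fill_bij : bijective fill }.

Lemma card_box : #|box| = n.
Proof.
have /and3P[_ _ /eqP sum_la] := valP la.
rewrite -[RHS]sum_la card_tagged !sumnE big_map big_enum /= [RHS](big_nth 0%N).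
by rewrite big_mkord; apply: eq_bigr => i _; exact: card_ord.
Qed.

Lemma tableau_exists : inhabited tableau.
Proof.
constructor; exists (fun b => cast_ord card_box (enum_rank b)).
apply: (bij_comp (h := enum_rank)); last exact: enum_rank_bij.
by exists (cast_ord (esym card_box)); [exact: cast_ordK | exact: cast_ordKV].
Qed.

Variable T : tableau.

Definition row_stab : {set 'S_n} :=
  [set s : 'S_n | [forall b, exists b', (row_of b' == row_of b)
                                         && (s (T b) == T b')]].
Definition col_stab : {set 'S_n} :=
  [set s : 'S_n | [forall b, exists b', (col_of b' == col_of b)
                                         && (s (T b) == T b')]].

Definition row_sum : group_ring 'S_n := \sum_(s in row_stab) gr_elt s.
Definition col_sum : group_ring 'S_n :=
  \sum_(s in col_stab) gr_elt s *~ ((-1) ^+ odd_perm s).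

Definition specht_ideal : {pred (group_ring 'S_n)^o} :=
  fun x => `[< exists y, x = y * col_sum * row_sum >].

Fact specht_ideal_closed : submod_closed specht_ideal.
Proof.
split=> [|a _ _ /asboolP[x ->] /asboolP[y ->]]; apply/asboolP.
  by exists 0; rewrite !mul0r.
by exists (a * x + y); rewrite !mulrDl -!mulrA.
Qed.
HB.instance Definition _ := GRing.isSubmodClosed.Build
  (group_ring 'S_n) (group_ring 'S_n)^o specht_ideal specht_ideal_closed.

(* MathComp multiplies permutations from left to right; this is immaterial    *)
(* here, since inversion is an isomorphism between the two versions of the    *)
(* symmetric group and fixes the row, column and Young subgroups as sets and  *)
(* the elements row_sum and col_sum.                                          *)
Definition specht : lmodType (group_ring 'S_n) := submod specht_ideal.
End Tableau.

Definition interlacing t n (la : intpart t) (nu : intpart n) : bool :=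
  [forall i : 'I_n, part la i <= part nu i]%N &&
  [forall i : 'I_n.-1, part nu i.+1 <= part la i]%N.

Definition induced_from_young t n (le_tn : (t <= n)%N)
    (M : lmodType (group_ring 'S_t)) : lmodType (group_ring 'S_n) :=
  induced (young_perm le_tn) (outer_tensor M (trivial_module 'S_(n - t))).

(* Main.v *)
Require Import Defs.
From HB Require Import structures.
From mathcomp Require Import all_boot all_order all_algebra all_fingroup.
From mathcomp Require Import generic_quotient boolp freeg zify.

(** Tabloids are encoded as words: maps from the n positions to row indices,
permuted by the symmetric group.  The polytabloid of a filling with row word
rho and column word kap is the signed sum of the words of the form rho o s, for
s in the stabilizer of kap.  In the same way, the induced module becomes a
module of integer functions on words over the finite letters 0, .., n - 1 and
one further letter n, read as infinity: it is generated by a polytabloid of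
shape la whose n - t remaining positions all carry the letter infinity.

Replacing every infinity by finite letters in all possible ways is equivariant;
[spread] is this map on coefficients.  Restricting the result to the words of a
given content nu gives an equivariant map from the induced module to the tabloid
module of nu.  List the contents interlacing with la by decreasing height, that
is, by decreasing sum of i * nu_i, and let the i-th step of the series consist of
the vectors whose images vanish at all contents from the i-th on.  For m = 0 the
factor at nu is then by construction embedded in the tabloid module of nu, and
the theorem follows from three facts.

- Only horizontal strips survive.  In a polytabloid of shape la, the letters i
  and i + 1 occupy la_i columns, so that any set of more than la_i positions
  carrying only these letters has two positions in one column, and signed or
  symmetric sums over such a set vanish ([two_row_relation_colsum]).  If all
  contents of smaller height are killed, this forces a content to be killed as
  soon as i + 1 occurs more than la_i times ([spread_alternating]); hence a
  vector killed by all interlacing contents is zero ([spread_vanish],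
  [spread_injective]).

- The image is contained in the Specht module.  The same relation shows that
  the image at nu is annihilated by all maps turning letters i + 1 into i
  ([spread_two_row], [spread_james_kernel]).  An integer function on the words
  of content nu with this property is an integral combination of polytabloids:
  its lexicographically largest word is the row word of a standard filling, and
  the polytabloid of that filling can be subtracted
  ([james_kernel_polytabloids]).  The property persists under division by m,
  which is what makes the argument work modulo m.

- The image is the whole Specht module.  Put infinity in the boxes of nu outside
  la and antisymmetrize along the columns of nu.  The result lies in the induced
  module ([horizontal_comb]), and, as infinity sits at the foot of its column,
  the least letters that can replace it are the rows of nu; so the image is the
  polytabloid of nu, and it is zero at the other contents of at most the same
  height ([spread_horizontal]).

The series is transported to the tensor product by the surjection
y |-> y (x) generator, whose kernel contains the y with zero associated function
([ind_gen_word0]) and consists of y whose function is divisible by m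
([ind_gen_dvd]). *)

Set Implicit Arguments.
Unset Strict Implicit.
Unset Printing Implicit Defensive.
Import GRing.Theory.

(** * Words and stabilizer sums *)

Section AdditiveMaps.
Local Open Scope ring_scope.
Variables (V W : zmodType) (f : V -> W).
Hypothesis fD : {morph f : x y / x + y}.

Lemma morph_add0 : f 0 = 0.
Proof. by apply: (addrI (f 0)); rewrite -fD !addr0. Qed.
Lemma morph_addN x : f (- x) = - f x.
Proof. by apply: (addrI (f x)); rewrite -fD !subrr morph_add0. Qed.
Lemma morph_addB x y : f (x - y) = f x - f y.
Proof. by rewrite fD morph_addN. Qed.
Lemma morph_addMn x k : f (x *+ k) = f x *+ k.
Proof. by elim: k => [|k IHk]; rewrite ?mulr0n ?morph_add0 // !mulrS fD IHk. Qed.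
Lemma morph_addMz x (k : int) : f (x *~ k) = f x *~ k.
Proof. by case: k => k; rewrite ?NegzE ?mulrNz ?morph_addN -?pmulrn morph_addMn. Qed.
End AdditiveMaps.

Section GroupRingFacts.
Local Open Scope ring_scope.
Variable gT : finGroupType.
Implicit Types (x y : group_ring gT) (g h : gT).

Lemma gr_mulrzE x (k : int) g : (x *~ k) g = x g *~ k.
Proof. by case: k => k; rewrite ?NegzE ?mulrNz ?ffunE -?pmulrn ffunMnE. Qed.

Lemma gr_eltMl g x h : (gr_elt g * x) h = x (g^-1 * h)%g.
Proof.
rewrite gr_mulE (bigD1 g) //= ffunE eqxx mul1r big1 ?addr0 // => k /negPf kg.
by rewrite ffunE kg mul0r.
Qed.

Lemma gr_sum_elt x : x = \sum_g gr_elt g *~ x g.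
Proof.
apply/ffunP => h; rewrite sum_ffunE (bigD1 h) //= gr_mulrzE ffunE eqxx intz.
rewrite big1 ?addr0 // => g; rewrite eq_sym => /negPf gh.
by rewrite gr_mulrzE ffunE gh mul0rz.
Qed.

Lemma additive_gr_sum (V : zmodType) (f : group_ring gT -> V) x :
  {morph f : y z / y + z} -> f x = \sum_g f (gr_elt g) *~ x g.
Proof.
move=> fD; rewrite {1}[x]gr_sum_elt (big_morph f fD (morph_add0 fD)).
by apply: eq_bigr => g _; rewrite morph_addMz.
Qed.

Lemma sum_lcosets (V : zmodType) (H G : {group gT}) (F : gT -> V) : H \subset G ->
  \sum_(g in G) F g
    = \sum_(C in lcosets H G) \sum_(h in H) F (fingroup.repr C * h)%g.
Proof.
move=> sub.
rewrite (partition_big (fun h => h *: H)%g (mem (lcosets H G))) /=; last first.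
  by move=> h hs; apply/lcosetsP; exists h.
apply: eq_bigr => C /lcosetsP[g gs defC].
have rgH : fingroup.repr C \in (g *: H)%g 
  by rewrite defC; apply: mem_repr (lcoset_refl H g).
have Cr : (fingroup.repr C *: H)%g = C by rewrite {2}defC; apply/lcoset_eqP.
have rs : fingroup.repr C \in G.
  by case/lcosetP: rgH => k kH ->; apply: groupM => //; apply: (subsetP sub).
rewrite (reindex_inj (mulgI (fingroup.repr C))) /=; apply: eq_bigl => k.
rewrite (groupMl _ rs) lcosetM -[X in (_ == X)]Cr.
rewrite (inj_eq (@lcoset_inj _ (fingroup.repr C) : injective _)).
apply/andP/idP => [[_ /eqP kH]|kH]; first by rewrite -kH lcoset_refl.
by rewrite (subsetP sub) // lcoset_id.
Qed.
End GroupRingFacts.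

Section Words.
Local Open Scope ring_scope.
Variable n : nat.

Definition word := {ffun 'I_n -> nat}.
Implicit Types (w rho kap : word) (g h s : 'S_n) (x y z : group_ring 'S_n).
Implicit Types (X Y Z : {set 'I_n}).

(** A left action: products of permutations compose from left to right. *)
Definition wact g w : word := [ffun a => w (g a)].

Lemma wactM g h w : wact (g * h) w = wact g (wact h w).
Proof. by apply/ffunP => a; rewrite !ffunE permM. Qed.
Lemma wact1 w : wact 1 w = w.
Proof. by apply/ffunP => a; rewrite !ffunE perm1. Qed.
Lemma wactK g : cancel (wact g) (wact g^-1).
Proof. by move=> w; rewrite -wactM mulVg wact1. Qed.
Lemma wactKV g : cancel (wact g^-1) (wact g).
Proof. by move=> w; rewrite -wactM mulgV wact1. Qed.

Lemma wact_eq g w v : (wact g w == v) = (w == wact g^-1 v).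
Proof. by apply/eqP/eqP => [<-|->]; rewrite (wactK, wactKV). Qed.

Definition wstab w : {set 'S_n} := [set s | wact s w == w].

Fact wstab_group_set w : group_set (wstab w).
Proof.
apply/group_setP; split=> [|g h]; rewrite !inE ?wact1 // wactM.
by move=> /eqP gw /eqP ->; rewrite gw.
Qed.
Canonical wstab_group w := Group (wstab_group_set w).

Lemma wstabJ g kap s : (s \in wstab (wact g kap)) = ((g^-1 * s * g)%g \in wstab kap).
Proof.
by rewrite !inE !wactM [RHS]wact_eq invgK.
Qed.

Lemma tperm_wstab w a b : w a = w b -> tperm a b \in wstab w.
Proof.
move=> wab; rewrite inE; apply/eqP/ffunP => c; rewrite !ffunE.
by case: tpermP => // ->.
Qed.

Definition rowsum rho : group_ring 'S_n := \sum_(s in wstab rho) gr_elt s.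
Definition colsum kap : group_ring 'S_n :=
  \sum_(s in wstab kap) gr_elt s *~ ((-1) ^+ odd_perm s).

Lemma rowsumE rho g : rowsum rho g = (g \in wstab rho)%:R.
Proof.
rewrite /rowsum sum_ffunE; under eq_bigr do rewrite ffunE.
case: (boolP (g \in _)) => gs; first rewrite (bigD1 g) //= eqxx big1 ?addr0 //.
  by move=> h /andP[_ /negPf]; rewrite eq_sym => ->.
by rewrite big1 // => h hs; case: eqP gs => // ->; rewrite hs.
Qed.

Lemma colsumE kap g :
  colsum kap g = (g \in wstab kap)%:R * (-1) ^+ odd_perm g.
Proof.
rewrite /colsum sum_ffunE.
under eq_bigr do rewrite gr_mulrzE ffunE -mulrzr intz.
case: (boolP (g \in _)) => gs; first rewrite (bigD1 g) //= eqxx big1 ?addr0 //.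
  by move=> h /andP[_ /negPf]; rewrite eq_sym => ->; rewrite mul0r.
by rewrite big1 ?mul0r // => h hs; case: eqP gs => [->|]; rewrite ?hs ?mul0r.
Qed.

(** The element x . rho of the permutation module spanned by the words, given by
its coefficients.  With rho the row word of a tableau, this is the tabloid
module. *)
Definition wcomb x rho w : int := \sum_(h | wact h rho == w) x h.

Lemma wcombD x y rho w : wcomb (x + y) rho w = wcomb x rho w + wcomb y rho w.
Proof. by rewrite -big_split; apply: eq_bigr => h _; rewrite ffunE. Qed.
Lemma wcombN x rho w : wcomb (- x) rho w = - wcomb x rho w.
Proof. by rewrite -sumrN; apply: eq_bigr => h _; rewrite ffunE. Qed.
Lemma wcomb0 rho w : wcomb 0 rho w = 0.
Proof. by apply: big1 => h _; rewrite ffunE. Qed.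
Lemma wcombMn x k rho w : wcomb (x *+ k) rho w = wcomb x rho w *+ k.
Proof. by elim: k => [|k IHk]; rewrite ?mulr0n ?wcomb0 // !mulrS wcombD IHk. Qed.
Lemma wcombMz x (k : int) rho w : wcomb (x *~ k) rho w = wcomb x rho w *~ k.
Proof.
by case: k => k; rewrite ?NegzE ?mulrNz ?wcombN -?pmulrn wcombMn.
Qed.

Lemma wcombM z x rho w :
  wcomb (z * x) rho w = \sum_g z g * wcomb x rho (wact g^-1 w).
Proof.
rewrite /wcomb; under eq_bigr do rewrite gr_mulE.
rewrite exchange_big; apply: eq_bigr => g _; rewrite big_distrr /=.
rewrite (reindex_inj (mulgI g)) /=; apply: eq_big => [h|h _]; last by rewrite mulKg.
by rewrite wactM wact_eq.
Qed.

Lemma wcomb_elt g x rho w : wcomb (gr_elt g * x) rho w = wcomb x rho (wact g^-1 w).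
Proof.
rewrite wcombM (bigD1 g) //= ffunE eqxx mul1r big1 ?addr0 // => h /negPf hg.
by rewrite ffunE hg mul0r.
Qed.

(** A group ring element multiplied by the stabilizer sum of rho is constant on
the cosets of the stabilizer, hence is the same thing as a function on the orbit
of rho.  This identifies the ideals defining Specht modules with modules of
functions on words. *)
Lemma wcomb_rowsum x rho g : (x * rowsum rho) g = wcomb x rho (wact g rho).
Proof.
rewrite gr_mulE /wcomb [RHS]big_mkcond; apply: eq_bigr => h _ /=.
rewrite rowsumE inE wactM wact_eq invgK eq_sym.
by case: eqP; rewrite ?mulr1 ?mulr0.
Qed.

Lemma wcomb_orbit x rho w : wcomb x rho w != 0 -> exists g, w = wact g rho.
Proof.
move=> xw; have [g /eqP gw|none] := pickP (fun g => wact g rho == w).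
  by exists g.
by case/eqP: xw; apply: big_pred0.
Qed.

Lemma wcomb_wact x rho g w : wcomb x (wact g rho) w = wcomb (x * gr_elt g) rho w.
Proof.
rewrite /wcomb [RHS](reindex_inj (mulIg g)) /=; apply: eq_big => [h|h _].
  by rewrite wactM.
rewrite gr_mulE (bigD1 h) //= ffunE mulKg eqxx mulr1 big1 ?addr0 // => k hk.
rewrite ffunE; case: eqP => [e|]; rewrite ?mulr0 //.
by case/eqP: hk; apply: (@mulIg _ g); rewrite -{1}e mulKVg.
Qed.

Lemma colsum_wact g kap :
  colsum (wact g kap) * gr_elt g = gr_elt g * colsum kap.
Proof.
apply/ffunP => h; rewrite !gr_mulE.
rewrite (bigD1 (h * g^-1)%g) //= invMg invgK -mulgA mulVg mulg1 ffunE eqxx mulr1.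
rewrite [X in _ + X]big1 => [|k kh]; last first.
  rewrite [X in _ * X]ffunE; case: eqP => [e|]; rewrite ?mulr0 //.
  by case/eqP: kh; rewrite -e invMg invgK mulKVg.
rewrite (bigD1 g) //= [gr_elt g g]ffunE eqxx mul1r 
  [X in _ = _ + X]big1 => [|k kg]; last first.
  by rewrite ffunE (negPf kg) mul0r.
rewrite !addr0 !colsumE wstabJ -!mulgA mulVg mulg1 !odd_permM !odd_permV.
by rewrite addbC.
Qed.

(** The larger antisymmetrizer is the smaller one followed by a signed transversal
of cosets; unlike an average over the group, this needs no division. *)
Lemma colsum_factor kap kap' : wstab kap' \subset wstab kap ->
  exists x, colsum kap = x * colsum kap'.
Proof.
move=> sub; pose K := wstab_group kap'.
exists (\sum_(C in lcosets K (wstab kap))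
   gr_elt (fingroup.repr C) *~ ((-1) ^+ odd_perm (fingroup.repr C))).
rewrite big_distrl /= {1}/colsum (@sum_lcosets _ _ K (wstab_group kap)) //.
apply: eq_bigr => C _; rewrite /colsum big_distrr /=; apply: eq_bigr => k _.
rewrite odd_permM signr_addb gr_eltM.
by case: (odd_perm _); case: (odd_perm _); 
  rewrite ?mul1r ?mulr1 ?mulrN1z ?mulr1z ?mulrNN ?mulNr ?mulrN.
Qed.
End Words.

(** * Two-row relations and the spreading of the infinite letter *)

Section Relations.
Local Open Scope ring_scope.
Variable n : nat.
Local Notation word := (word n).
Implicit Types (w rho kap : word) (g h s t : 'S_n) (x y z : group_ring 'S_n).
Implicit Types (X Y Z : {set 'I_n}) (f : word -> int).

Lemma wcomb_colsumM z kap rho w :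
  wcomb (z * colsum kap) rho w
    = \sum_g z g * wcomb (colsum (wact g kap)) (wact g rho) w.
Proof.
rewrite wcombM; apply: eq_bigr => g _.
by rewrite -wcomb_elt -colsum_wact wcomb_wact.
Qed.

Lemma wcomb_colsum_anti kap rho t w : t \in wstab kap ->
  wcomb (colsum kap) rho (wact t w)
    = (-1) ^+ odd_perm t * wcomb (colsum kap) rho w.
Proof.
move=> ts; rewrite /wcomb big_distrr /=.
rewrite (reindex_inj (mulgI t)) /=; apply: eq_big => [h|h _].
  by rewrite wactM (inj_eq (can_inj (wactK t))).
rewrite !colsumE (groupMl _ (ts : t \in wstab_group kap)) odd_permM.
by rewrite signr_addb mulrCA.
Qed.

Lemma wcomb_colsum_supp kap rho w : wcomb (colsum kap) rho w != 0 ->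
  exists2 s, s \in wstab kap & w = wact s rho.
Proof.
move=> nz; have [s /andP[ss /eqP sw]|none] :=
    pickP (fun s => (s \in wstab kap) && (wact s rho == w)); first by exists s.
case/eqP: nz; apply: big1 => h hw; rewrite colsumE.
by have := none h; rewrite hw andbT => ->; rewrite mul0r.
Qed.

Lemma wcomb_colsum_eq0 kap rho w a b : a != b -> kap a = kap b -> w a = w b ->
  wcomb (colsum kap) rho w = 0.
Proof.
move=> ab kab wab; have := wcomb_colsum_anti rho w (tperm_wstab kab).
have := tperm_wstab wab; rewrite inE => /eqP ->; rewrite odd_tperm ab expr1.
lia.
Qed.

Definition blank X w : word := [ffun a => if a \in X then n else w a].
Definition fill i Z Y w : word :=
  [ffun a => if a \in Z then (if a \in Y then i.+1 else i) else w a].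

(** The positions in X carry infinity, those in Z outside X only the letters i and
i + 1.  The weight phi depends on the number of positions chosen in Z, those
in X included: this gives both the sums over subsets of fixed cardinality and
the alternating sums. *)
Definition two_row_relation f i c := forall X Z w (phi : nat -> int),
  (c < #|Z :\: X|)%N ->
  \sum_(Y : {set 'I_n} | Y \subset Z) phi #|Y| * f (blank X (fill i Z Y w)) = 0.

(** The pigeonhole principle.  If two free positions of Z lie in the same column,
their transposition permutes the summands, preserves the weights and changes the
sign of the antisymmetric function.  Otherwise all free positions lie in
different columns, and the function vanishes at each of the words since only c
columns contain the letters i and i + 1. *)
Lemma two_row_relation_colsum kap rho i c :
  (forall a, rho a = i \/ rho a = i.+1 -> kap a < c)%N ->
  forall z, two_row_relation (wcomb (z * colsum kap) rho) i c.
Proof.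
move=> rk z X Z w phi cZ.
under eq_bigr do rewrite wcomb_colsumM big_distrr /=.
rewrite exchange_big big1 //= => g _.
under eq_bigr do rewrite mulrCA.
rewrite -big_distrr /= [X in _ * X](_ : _ = 0) ?mulr0 //.
have {rk} : (forall a, wact g rho a = i \/ wact g rho a = i.+1 ->
              wact g kap a < c)%N.
  by move=> a; rewrite !ffunE; apply: rk.
move: (wact g rho) (wact g kap) => {}rho {}kap rk.
have [[a b] /= /and4P[aZ bZ ab /eqP kab]|inj] :=
  pickP (fun ab : 'I_n * 'I_n => [&& ab.1 \in Z :\: X, ab.2 \in Z :\: X,
                                  ab.1 != ab.2 & kap ab.1 == kap ab.2]).
  set S := LHS; suff: S = - S by lia.
  pose t := tperm a b; have tt : involutive t by move=> d; rewrite /t tpermK.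
  have ts : t \in wstab kap by apply: tperm_wstab.
  have tX d : (t d \in X) = (d \in X).
    rewrite /t; case: tpermP => // ->; move: aZ bZ; rewrite !inE.
      by move=> /andP[/negPf-> _] /andP[/negPf->].
    by move=> /andP[/negPf-> _] /andP[/negPf->].
  have tZ d : (t d \in Z) = (d \in Z).
    rewrite /t; case: tpermP => // ->; move: aZ bZ; rewrite !inE.
      by move=> /andP[_ ->] /andP[_ ->].
    by move=> /andP[_ ->] /andP[_ ->].
  have td d : d \notin Z -> t d = d.
    move=> dZ; rewrite /t tpermD //; apply: contraNneq dZ => <-.
      by case/setDP: aZ.
    by case/setDP: bZ.
  rewrite {1}/S (reindex_inj (imset_inj (@perm_inj _ t))) /= -sumrN.
  apply: eq_big => [Y|Y YZ].
    apply/subsetP/subsetP => sub d dY.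
      by rewrite -tZ; apply: sub; apply: imset_f.
    by case/imsetP: dY => e eY ->; rewrite tZ; apply: sub.
  rewrite card_imset; last exact: perm_inj.
  rewrite (_ : blank X (fill i Z (t @: Y) w) = wact t (blank X (fill i Z Y w))).
    by rewrite wcomb_colsum_anti // odd_tperm ab expr1 mulN1r mulrN.
  apply/ffunP => d; rewrite !ffunE tX; case: ifP => // _.
  rewrite tZ; case: ifPn => [_|/td-> //].
  by rewrite -{1}(tt d) mem_imset //; apply: perm_inj.
apply: big1 => Y YZ; apply/eqP; rewrite mulf_eq0; apply/orP; right.
apply: contraT => /wcomb_colsum_supp[s /[!inE] /eqP ks e].
move: cZ; rewrite ltnNge => /negP[].
have kc a : a \in Z :\: X -> (kap a < c)%N.
  move=> aZ; rewrite -ks ffunE; apply: rk.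
  have := congr1 (fun u : word => u a) e; rewrite !ffunE.
  case/setDP: aZ => -> /negPf-> <-; case: ifP => _; [by right|by left].
case: c kc {rk} => [|c] kc.
  by rewrite leqn0 cards_eq0; apply/set0Pn => -[a /kc].
rewrite -[c.+1]card_ord.
rewrite -(@card_in_imset _ _ (fun a => inord (kap a) : 'I_c.+1)) ?max_card //.
move=> a b aZ bZ /(congr1 val); rewrite /= !inordK ?kc // => kab.
apply/eqP; apply: contraFT (inj (a, b)) => ab.
by rewrite /= aZ bZ ab kab eqxx.
Qed.

(** The transpose of replacing infinity by arbitrary finite letters: the words
that can be turned into w are obtained from it by blanking a set of positions. *)
Definition spread f w : int := \sum_(X : {set 'I_n}) f (blank X w).

Definition occ w i := #|[set a | w a == i]|.

Lemma occ_wact g w i : occ (wact g w) i = occ w i.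
Proof.
rewrite /occ -[RHS](card_imset _ (@perm_inj _ g^-1)); apply: eq_card => a.
rewrite inE ffunE -[a in RHS](permK g) mem_imset ?inE //; exact: perm_inj.
Qed.

Lemma occ_wcomb x rho w i : wcomb x rho w != 0 -> occ w i = occ rho i.
Proof. by case/wcomb_orbit => g ->; rewrite occ_wact. Qed.

(** If a blanked position lies in Z, then adding it to Y or removing it from Y
changes the sign only; so the terms with a blank in Z cancel, and the others
vanish by the two-row relation. *)
Lemma spread_alternating f i l Z w : two_row_relation f i l -> (l < #|Z|)%N ->
  \sum_(Y : {set 'I_n} | Y \subset Z) (-1) ^+ #|Y| * spread f (fill i Z Y w) = 0.
Proof.
move=> fR lZ; rewrite /spread.
under eq_bigr do rewrite big_distrr /=.
rewrite exchange_big big1 //= => X _.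
have [XZ|/set0Pn[a /setIP[aX aZ]]] := eqVneq (X :&: Z) set0.
  apply: (fR X Z w (fun k => (-1) ^+ k)).
  rewrite (_ : Z :\: X = Z) //; apply/setDidPl.
  by rewrite disjoint_sym -setI_eq0 XZ.
set S := LHS; suff: S = - S by lia.
pose tog Y := if a \in Y then Y :\ a else a |: Y.
have togK : involutive tog.
  move=> Y; rewrite /tog; have [aY|aY] := boolP (a \in Y).
    by rewrite setD11 setD1K.
  by rewrite setU11 setU1K.
rewrite {1}/S (reindex_inj (inv_inj togK)) /= -sumrN.
apply: eq_big => [Y|Y YZ].
  rewrite /tog; case: ifP => aY; last by rewrite subUset sub1set aZ.
  by rewrite -{2}(setD1K aY) subUset sub1set aZ.
rewrite (_ : blank X _ = blank X (fill i Z Y w)).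
  rewrite -mulNr; congr (_ * _); rewrite /tog; case: ifPn => aY.
    by rewrite (cardsD1 a Y) aY add1n exprS mulN1r opprK.
  by rewrite cardsU1 aY exprS mulN1r.
apply/ffunP => b; rewrite !ffunE; case: ifPn => // bX; case: ifP => // _.
have ba : b != a by apply: contraNneq bX => ->.
by rewrite /tog; case: (a \in Y); rewrite !inE (negPf ba).
Qed.

(** All letters i lie in Z, and exactly l of them are left after blanking.  If more
than l positions of Z are free, the sum over Y vanishes by the two-row relation.
If exactly l are free, all of these carry i, and so Y is any j-subset of the
blanked part of Z, which has #|Z| - l elements. *)
Lemma spread_two_row f i l Z w j : two_row_relation f i l ->
  (forall v, f v != 0 -> occ v i = l) -> (i < n)%N ->
  (forall a, a \notin Z -> w a != i) ->
  \sum_(Y : {set 'I_n} | (Y \subset Z) && (#|Y| == j)) spread f (fill i Z Y w)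
     = spread f (fill i Z set0 w) *+ 'C(#|Z| - l, j).
Proof.
move=> fR fl lin wZ; rewrite /spread exchange_big -sumrMnl; apply: eq_bigr => X _ /=.
have occE Y : Y \subset Z ->
    occ (blank X (fill i Z Y w)) i = #|(Z :\: X) :\: Y|.
  move=> YZ; apply: eq_card => a; rewrite !inE !ffunE.
  case: (a \in X); first by rewrite andbF (gtn_eqF lin).
  case: ifPn => [aZ|/wZ/negPf->]; rewrite ?andbF //.
  by case: ifP; rewrite ?eqxx //= gtn_eqF.
have [lt|gt|eq] := ltngtP #|Z :\: X| l.
- rewrite big1 => [|Y /andP[YZ _]].
    rewrite (_ : f _ = 0) ?mul0rn //; apply/eqP; apply: contraTT lt => /fl.
    by rewrite occE ?sub0set // setD0 => ->; rewrite ltnn.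
  apply/eqP; apply: contraTT lt => /fl; rewrite occE // -leqNgt => <-.
  by rewrite subset_leq_card ?subsetDl.
- have := fR X Z w (fun k => (k == j)%:R) gt.
  rewrite big_mkcondr /= => e; rewrite -[RHS]addr0 -[in RHS]e.
  rewrite (_ : f (blank X (fill i Z set0 w)) = 0) ?mul0rn ?add0r.
    by apply: eq_bigr => Y _; case: eqP; rewrite ?mul1r ?mul0r.
  apply/eqP; apply: contraTT gt => /fl.
  by rewrite occE ?sub0set // setD0 => ->; rewrite ltnn.
have ZX : (#|Z| - l = #|Z :&: X|)%N by rewrite -eq -(cardsID X Z) addnK.
rewrite ZX -cards_draws -sumr_const big_mkcond [RHS]big_mkcond /=.
apply: eq_bigr => Y _; rewrite inE.
have [YZX|YZX] := boolP (Y \subset Z :&: X).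
  have YZ : Y \subset Z by apply: subset_trans YZX (subsetIl _ _).
  rewrite YZ /=; case: eqP => // _; congr f; apply/ffunP => a; rewrite !ffunE.
  case: ifPn => // aX; case: ifP => // _; rewrite inE; case: ifP => // aY.
  by case/negP: aX; have /setIP[] := subsetP YZX _ aY.
rewrite /=; case: ifP => // /andP[YZ _]; apply/eqP; apply: contraNT YZX.
move=> /fl; rewrite occE // -eq => e; rewrite subsetI YZ /=.
have /eqP := e; rewrite -(cardsID Y (Z :\: X)).
rewrite -[X in X == _]add0n eqn_add2r eq_sym cards_eq0 => /eqP e0.
apply/subsetP => a aY; apply/negPn/negP => aX.
have : a \in (Z :\: X) :&: Y by rewrite !inE aX aY (subsetP YZ).
by rewrite e0 inE.
Qed.
End Relations.

(** * Integral kernel theorem for polytabloids *)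

Section TableauWords.
Variables (n : nat) (la : intpart n) (T : tableau la).

Fact fill_onto a : a \in codom T.
Proof. by have [T' _ TK] := fill_bij T; rewrite -(TK a) codom_f. Qed.
Definition box_at a : box la := iinv (fill_onto a).
Lemma box_atK : cancel box_at T.
Proof. by move=> a; apply: f_iinv. Qed.
Lemma fillK : cancel T box_at.
Proof. by move=> b; apply: iinv_f; apply: bij_inj (fill_bij T). Qed.

Definition rowword : word n := [ffun a => @row_of n la (box_at a)].
Definition colword : word n := [ffun a => @col_of n la (box_at a)].

Lemma box_eqP (b b' : box la) : row_of b = row_of b' -> col_of b = col_of b' -> b = b'.
Proof.
case: b b' => [i j] [i' j']; rewrite /row_of /col_of /= => /val_inj eqi.
by case: i' / eqi j' => j' /val_inj ->.
Qed.

Lemma col_lt_part (b : box la) : (col_of b < part la (row_of b))%N.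
Proof. exact: ltn_ord. Qed.

Lemma box_exists i j : (j < part la i)%N ->
  exists b : box la, row_of b = i /\ col_of b = j.
Proof.
move=> ji; have isz : (i < size la)%N.
  by rewrite ltnNge; apply: contraL ji => szi; rewrite /part nth_default.
by exists (Tagged (fun i : 'I_(size la) => 'I_(part la i)) 
  (Ordinal ji : 'I_(part la (Ordinal isz)))).
Qed.

Lemma row_stabE : row_stab T = wstab rowword.
Proof.
apply/setP => s; rewrite !inE; apply/forallP/eqP => [sT|sT b].
  apply/ffunP => a; rewrite !ffunE.
  have /existsP[b /andP[/eqP bb /eqP sb]] := sT (box_at a).
  by rewrite -bb box_atK in sb *; rewrite sb fillK.
apply/existsP; exists (box_at (s (T b))); rewrite box_atK eqxx andbT.
by have /ffunP/(_ (T b)) := sT; rewrite !ffunE fillK => ->.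
Qed.
Lemma col_stabE : col_stab T = wstab colword.
Proof.
apply/setP => s; rewrite !inE; apply/forallP/eqP => [sT|sT b].
  apply/ffunP => a; rewrite !ffunE.
  have /existsP[b /andP[/eqP bb /eqP sb]] := sT (box_at a).
  by rewrite -bb box_atK in sb *; rewrite sb fillK.
apply/existsP; exists (box_at (s (T b))); rewrite box_atK eqxx andbT.
by have /ffunP/(_ (T b)) := sT; rewrite !ffunE fillK => ->.
Qed.
Lemma row_sumE : row_sum T = rowsum rowword.
Proof. by rewrite /row_sum row_stabE. Qed.
Lemma col_sumE : col_sum T = colsum colword.
Proof. by rewrite /col_sum col_stabE. Qed.

Lemma rowcol_inj a b : rowword a = rowword b -> colword a = colword b -> a = b.
Proof.
by rewrite !ffunE => rab cab; apply: (can_inj box_atK); apply: box_eqP.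
Qed.

Lemma occ_rowword i : occ rowword i = part la i.
Proof.
rewrite /occ -[RHS]card_ord.
have [isz|szi] := ltnP i (size la); last first.
  rewrite [#|'I__|]card_ord /part nth_default //; apply/eqP; rewrite cards_eq0.
  apply/set0Pn => -[a]; rewrite inE ffunE /row_of => /eqP e.
  by move: (ltn_ord (tag (box_at a))); rewrite e ltnNge szi.
pose F (j : 'I_(part la i)) : box la :=
  Tagged (fun i : 'I_(size la) => 'I_(part la i))
         (j : 'I_(part la (Ordinal isz))).
have Finj : injective F by move=> j k /(congr1 (@col_of n la)) /val_inj.
rewrite -(card_imset _ (inj_comp (bij_inj (fill_bij T)) Finj)).
apply: eq_card => a; rewrite inE ffunE; apply/eqP/imsetP => [ai|[j _ ->]]; last first.
  by rewrite /= fillK.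
have cj : (col_of (box_at a) < part la i)%N by rewrite -ai col_lt_part.
by exists (Ordinal cj) => //=; rewrite -[LHS]box_atK; congr (T _); apply: box_eqP.
Qed.

Lemma part_le i j : (i <= j)%N -> (part la j <= part la i)%N.
Proof.
move=> ij; have /and3P[srt _ _] := valP la.
have [jsz|szj] := ltnP j (size la); last by rewrite {1}/part nth_default.
rewrite /part; have [->//|neq] := eqVneq i j.
have gt : transitive geq.
  by move=> a b c; rewrite /geq /= => ba ac; apply: leq_trans ac ba.
by apply: (sorted_ltn_nth gt) => //; rewrite ?inE; lia.
Qed.

End TableauWords.

Lemma intpart_size n (la : intpart n) : (size la <= n)%N.
Proof.
have /and3P[_ + /eqP sz] := valP la; rewrite -[X in (_ <= X)%N]sz.
have aux (s : seq nat) : 0%N \notin s -> (size s <= sumn s)%N.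
  by elim: s => //= a s IHs; rewrite inE negb_or => /andP[a0 /IHs]; lia.
exact: aux.
Qed.

Lemma part_size n (la : intpart n) i : (n <= i)%N -> part la i = 0%N.
Proof.
by move=> ni; rewrite /part nth_default // (leq_trans (intpart_size la)).
Qed.

Section Leading.
Variable n : nat.
Local Notation word := (word n).
Implicit Types (w v : word) (a b : 'I_n).

(** Words read as numbers in base n + 1 with the last position leading: an injective
measure of the lexicographic order [lexlt] on the words of a given content. *)
Definition weight w := (\sum_(a < n) w a * n.+1 ^ a)%N.

Definition lexlt w v := exists2 a, (w a < v a)%N & forall b, (a < b)%N -> w b = v b.

Lemma lexlt_total w v : w <> v -> lexlt w v \/ lexlt v w.
Proof.
move=> wv; have [a0 a0P] : exists a, w a != v a.
  apply/existsP; apply: contra_notT wv; rewrite negb_exists => /forallP e.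
  by apply/ffunP => a; apply/eqP; rewrite -[_ == _]negbK.
have [a aP amax] := @arg_maxnP _ a0 (fun a => w a != v a) (fun a => val a) a0P.
have hi b : (a < b)%N -> w b = v b.
  move=> ab; apply/eqP; apply: contraTT ab => /amax; rewrite -leqNgt; exact.
case: (ltngtP (w a) (v a)) aP => // lt _; [left|right]; exists a => // b ab.
by rewrite hi.
Qed.
End Leading.

Lemma digits_bound n (w : 'I_n -> nat) B : (forall a, w a < B)%N ->
  (\sum_(a < n) w a * B ^ a < B ^ n)%N.
Proof.
elim: n w => [|n IHn] w wB; first by rewrite big_ord0.
rewrite big_ord_recr /= expnS; have := wB ord_max.
have := IHn (fun a => w (widen_ord (leqnSn n) a)) (fun a => wB _).
move: (\sum_(a < n) _)%N (B ^ n)%N => S M SM lt.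
have := leq_mul lt (leqnn M); rewrite mulSn; lia.
Qed.

Lemma digits_lt n (w v : 'I_n -> nat) B a : (forall b, w b < B)%N ->
    (w a < v a)%N -> (forall b : 'I_n, a < b -> w b = v b)%N ->
  (\sum_(a < n) w a * B ^ a < \sum_(a < n) v a * B ^ a)%N.
Proof.
elim: n w v a => [|n IHn] w v a wB lt hi; first by case: a lt hi.
rewrite !big_ord_recr /=; have [an|an] := ltnP a n.
  rewrite (hi ord_max an) ltn_add2r.
  have ea : a = widen_ord (leqnSn n) (Ordinal an) by apply: val_inj.
  apply: (IHn _ _ (Ordinal an)) => [b||b ab]; rewrite -?ea //.
  by apply: hi.
have ea : a = ord_max by apply: val_inj => /=; have := ltn_ord a; lia.
have := digits_bound (fun a : 'I_n => wB (widen_ord (leqnSn n) a)).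
move: lt; rewrite ea => lt bnd; have := leq_mul lt (leqnn (B ^ n)).
rewrite mulSn => H; apply: leq_trans (leq_trans H (leq_addl _ _)).
by rewrite ltn_add2r.
Qed.

Section Standard.
Local Open Scope ring_scope.
Variables (n : nat) (nu : intpart n) (T : tableau nu).
Local Notation word := (word n).
Implicit Types (w v : word) (a b : 'I_n) (Y Z : {set 'I_n}).

Definition has_content w := forall i, occ w i = part nu i.

Lemma has_content_wact g : has_content (wact g (rowword T)).
Proof. by move=> i; rewrite occ_wact occ_rowword. Qed.

Lemma content_bound w a : has_content w -> (w a < n)%N.
Proof.
move=> wnu; rewrite ltnNge; apply/negP => /(part_size nu); rewrite -wnu.
by apply/eqP; rewrite cards_eq0; apply/set0Pn; exists a; rewrite inE.
Qed.

Lemma weight_lt w v : has_content w -> lexlt w v -> (weight w < weight v)%N.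
Proof.
move=> wnu [a lt hi]; apply: digits_lt lt hi => b.
exact: ltnW (content_bound b wnu).
Qed.

(** With row word w, this is the column word of the filling whose rows are
increasing; w is then the row word of a standard filling if and only if it is
strictly increasing along these columns. *)
Definition rank w : word := [ffun a => #|[set b | (w b == w a) && (b < a)%N]|].

Lemma rank_lt w a : has_content w -> (rank w a < part nu (w a))%N.
Proof.
move=> wnu; rewrite -wnu ffunE /occ; apply: proper_card; apply/properP; split.
  by apply/subsetP => b; rewrite !inE => /andP[].
by exists a; rewrite !inE ?eqxx ?ltnn.
Qed.

Lemma rank_mono w a b : w a = w b -> (a < b)%N -> (rank w a < rank w b)%N.
Proof.
move=> wab ab; rewrite !ffunE; apply: proper_card; apply/properP; split.
  by apply/subsetP => c; rewrite !inE wab => /andP[-> /ltn_trans->].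
by exists a; rewrite !inE ?wab ?eqxx ?ltnn ?ab // andbF.
Qed.

Lemma rank_inj w a b : w a = w b -> rank w a = rank w b -> a = b.
Proof.
move=> wab rab; apply: val_inj; case: (ltngtP a b) => // ab.
  by have := rank_mono wab ab; rewrite rab ltnn.
by have := rank_mono (esym wab) ab; rewrite rab ltnn.
Qed.

Lemma rank_tableau w : has_content w ->
  exists g, w = wact g (rowword T) /\ rank w = wact g (colword T).
Proof.
move=> wnu; have ex a := box_exists (rank_lt a wnu).
have ex' a : {b : box nu | (row_of b == w a) && (col_of b == rank w a)}.
  by apply: sigW; have [b [rb cb]] := ex a; exists b; rewrite rb cb !eqxx.
have Finj : injective (fun a => T (sval (ex' a))).
  move=> a b /(bij_inj (fill_bij T)) e.
  case: (ex' a) (ex' b) e => [B /andP[/eqP ra /eqP ca]] [B' /andP[/eqP rb /eqP cb]] /= e.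
  by apply: (@rank_inj w); rewrite -?ra -?rb -?ca -?cb e.
exists (perm Finj); split; apply/ffunP => a.
  by rewrite ffunE permE ffunE fillK; case: (ex' a) => B /= /andP[/eqP].
by rewrite [RHS]ffunE permE [RHS]ffunE fillK; case: (ex' a) => B /= /andP[_ /eqP].
Qed.

Lemma rank_surj w b i : has_content w -> (i < w b)%N ->
  exists2 a, w a = i & rank w a = rank w b.
Proof.
move=> wnu iw; have [g [ew er]] := rank_tableau wnu.
have lt : (rank w b < part nu i)%N.
  by apply: leq_trans (rank_lt b wnu) _; apply: part_le; apply: ltnW.
have [B [Bi Bc]] := box_exists lt.
by exists (g^-1 (T B))%g; rewrite ?er ?ew !ffunE permKV fillK // Bc er !ffunE.
Qed.

Definition column_strict w :=
  forall a b, rank w a = rank w b -> (a < b)%N -> (w a < w b)%N.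

(** Two rows that violate column strictness may be far apart; since the rows
between them are long enough to meet the same column, a violation also occurs
between two consecutive rows. *)
Lemma not_column_strict w : has_content w -> 
  (forall a b, w b = (w a).+1 -> rank w a = rank w b -> (a < b)%N) -> column_strict w.
Proof.
move=> wnu H a b rab ab; rewrite ltnNge; apply/negP => wba.
case: (ltngtP (w b) (w a)) wba => // [lt _|eq _]; last first.
  by have := rank_mono (esym eq) ab; rewrite rab ltnn.
have step k : forall c d, rank w c = rank w d -> w d = (w c + k.+1)%N -> (c < d)%N.
  elim: k => [|k IHk] c d rcd wd; first by apply: H => //; rewrite wd addn1.
  have wcd : (w c + k.+1 < w d)%N by lia.
  have [e we re] := rank_surj wnu wcd.
  have ce : (c < e)%N by apply: IHk => //; rewrite rcd re.
  by apply: ltn_trans ce _; apply: H; rewrite ?re // wd we addnS.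
have : (b < a)%N by apply: (step (w a - w b).-1); [rewrite rab | lia].
by lia.
Qed.

(** Consider the last position a moved to a different letter.  All later positions
are fixed, so a receives the letter of an earlier position of its column, and
this letter is smaller. *)
Lemma col_perm_lexlt w s : has_content w -> column_strict w ->
  s \in wstab (rank w) -> wact s w = w \/ lexlt (wact s w) w.
Proof.
move=> wnu cs; rewrite inE => /eqP/ffunP rs.
have rsE a : rank w (s a) = rank w a by have := rs a; rewrite ffunE.
have [->|/eqP neq] := eqVneq (wact s w) w; first by left.
right; case: (lexlt_total neq) => // -[a lt hi]; exfalso.
have fixhi b : (a < b)%N -> s b = b.
  by move=> ab; apply: (@rank_inj w) => //; rewrite (hi _ ab) ffunE.
have sa : s a <> a by move=> e; move: lt; rewrite ffunE e ltnn.
have lt_sa : (s a < a)%N.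
  case: (ltngtP (s a) a) => // [/fixhi/perm_inj//|/val_inj//].
by have := cs _ _ (rsE a) lt_sa; move: lt; rewrite ffunE; lia.
Qed.

Lemma leading_polytabloid w : has_content w -> column_strict w ->
  exists x, let e := wcomb (x * colsum (colword T)) (rowword T) in
    e w = 1 /\ (forall v, e v != 0 -> v = w \/ lexlt v w).
Proof.
move=> wnu cs; have [g [ew er]] := rank_tableau wnu.
exists (gr_elt g) => /=.
have E v : wcomb (gr_elt g * colsum (colword T)) (rowword T) v
        = wcomb (colsum (rank w)) w v.
  by rewrite -colsum_wact -wcomb_wact -ew -er.
split=> [|v]; rewrite E.
  rewrite /wcomb (bigD1 1%g) ?wact1 //= colsumE inE wact1 eqxx odd_perm1 expr0 mulr1.
  rewrite big1 ?addr0 // => s /andP[/eqP sw s1]; rewrite colsumE inE.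
  case: eqP => [rs|]; last by rewrite mul0r.
  case/eqP: s1; apply/permP => a; rewrite perm1; apply: (@rank_inj w).
    by rewrite -{2}sw ffunE.
  by rewrite -{2}rs [RHS]ffunE.
by case/wcomb_colsum_supp => s /(col_perm_lexlt wnu cs) H ->; apply: H.
Qed.

(** A function on words of content nu has this property if and only if it lies in
the intersection of the kernels of James's maps from the tabloid module of nu,
which turn j letters i + 1 into i. *)
Definition james_kernel (f : word -> int) :=
  forall i Z w j, (i.+1 < n)%N -> (forall a, a \notin Z -> w a != i) -> (0 < j)%N ->
  \sum_(Y : {set 'I_n} | (Y \subset Z) && (#|Y| == j)) f (fill i Z Y w) = 0.

(** Fewer than j letters i may be kept fixed outside Z: a fixed position is either
released into Z, or turned into i + 1, which reduces the number of fixed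
positions and, in the second case, also j; inclusion-exclusion in one step. *)
Lemma james_kernel_fixed f i Z w j : james_kernel f -> (i.+1 < n)%N ->
  (#|[set a | (a \notin Z) && (w a == i)]| < j)%N ->
  \sum_(Y : {set 'I_n} | (Y \subset Z) && (#|Y| == j)) f (fill i Z Y w) = 0.
Proof.
move=> f0 lt_in; move e : #|_| => k; elim: k j Z w e => [|k IHk] j Z w.
  move/eqP; rewrite cards_eq0 => /eqP e lt; apply: f0 => // a aZ.
  apply/negP => ai; have : a \in [set a | (a \notin Z) && (w a == i)].
    by rewrite inE aZ.
  by rewrite e inE.
move=> e; case: j => // j lt; rewrite ltnS in lt.
have /card_gt0P[a] : (0 < #|[set a | (a \notin Z) && (w a == i)]|)%N by rewrite e.
rewrite inE => /andP[aZ /eqP wa].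
pose w' : word := [ffun b => if b == a then i.+1 else w b].
have eZ : #|[set b | (b \notin a |: Z) && (w b == i)]| = k.
  move: e; rewrite (cardsD1 a) inE aZ wa eqxx add1n => -[<-].
  by apply: eq_card => b; rewrite !inE negb_or -!andbA.
have ew : #|[set b | (b \notin Z) && (w' b == i)]| = k.
  rewrite -eZ; apply: eq_card => b; rewrite !inE ffunE.
  by case: (eqVneq b a) => [->|//]; rewrite /= (gtn_eqF (ltnSn i)) andbF.
have := IHk j.+1 _ w eZ (ltnW lt).
rewrite (bigID (fun Y : {set 'I_n} => a \in Y)) /= [X in X + _](_ : _ = 0); last first.
  rewrite -[RHS](IHk j _ w' ew lt).
  rewrite (reindex_onto (fun Y => a |: Y) (fun Y => Y :\ a)) /=; last first.
    by move=> Y /andP[_ aY]; rewrite setD1K.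
  apply: eq_big => [Y|Y /andP[/andP[_ _] /eqP YaK]].
    rewrite setU11 andbT subUset sub1set setU11 /=.
    have [aY|aY] := boolP (a \in Y).
      rewrite [X in _ && X](_ : _ = false) ?andbF.
        by apply/esym/negP => /andP[/subsetP/(_ _ aY)]; rewrite (negPf aZ).
      by apply/eqP => /setP/(_ a); rewrite setD11 aY.
    rewrite setU1K // eqxx andbT cardsU1 aY add1n eqSS; congr (_ && _).
    by rewrite -{2}(setU1K aZ) subsetD1 aY andbT.
  congr f; apply/ffunP => b; rewrite !ffunE !inE.
  by have [->|] := eqVneq b a; rewrite //= (negPf aZ).
rewrite add0r => {2}<-; apply: eq_big => [Y|Y /andP[YZ _]].
  have [aY|aY] /= := boolP (a \in Y); rewrite ?andbF ?andbT.
    by apply/negP => /andP[/subsetP/(_ _ aY)]; rewrite (negPf aZ).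
  by rewrite -{1}(setU1K aZ) subsetD1 aY andbT.
congr f; apply/ffunP => b; rewrite !ffunE !inE.
have [->|] := eqVneq b a; rewrite //= (negPf aZ) ?wa; case: ifP => // aY.
by have := subsetP YZ _ aY; rewrite (negPf aZ).
Qed.

(** A dual form of the Garnir relations.  Suppose that, in column rank w a, the
entry b of row i + 1 precedes the entry a of row i.  Exchange the entries of
row i from a on with those of row i + 1 up to b in all ways: every exchange other
than the trivial one moves a later position to row i + 1, so it gives a larger
word, where f vanishes by maximality.  The relation then says f w = 0. *)
Lemma james_kernel_leading f w : james_kernel f -> has_content w ->
  (forall v, f v != 0 -> ~ lexlt w v) -> f w != 0 -> column_strict w.
Proof.
move=> f0 wnu top fw; apply: not_column_strict => // a b wb rab.
rewrite ltnNge leq_eqVlt; apply/negP => /orP[/eqP/val_inj eab|ba].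
  by move: wb; rewrite eab; lia.
have bn : ((w a).+1 < n)%N by rewrite -wb; apply: content_bound.
pose P := [set c | (w c == w a) && (a <= c)%N].
pose Q := [set c | (w c == w b) && (c <= b)%N].
have PQ c : c \in P -> c \in Q -> False.
  by rewrite !inE => /andP[_ ac] /andP[_ cb]; have := leq_trans ac cb; lia.
have Qcard : #|Q| = (rank w b).+1.
  rewrite ffunE (cardsD1 b) inE eqxx leqnn add1n; congr _.+1.
  apply: eq_card => c; rewrite !inE ltn_neqAle andbCA; congr (_ && _).
have lt : (#|[set c | (c \notin P :|: Q) && (w c == w a)]| < #|Q|)%N.
  rewrite Qcard -rab ltnS [rank w a]ffunE; apply: subset_leq_card.
  apply/subsetP => c; rewrite !inE negb_or => /andP[/andP[cP _] /eqP wc].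
  by move: cP; rewrite wc eqxx /= -ltnNge.
have := james_kernel_fixed f0 bn lt; rewrite Qcard -rab.
rewrite (bigD1 Q) /=; last by rewrite subsetUr Qcard rab eqxx.
rewrite [X in _ + X]big1 ?addr0 => [|Y /andP[/andP[YPQ Yc] YQ]]; last first.
  apply/eqP; apply: contraT => /top[].
  have /subsetPn[y yY yQ] : ~~ (Y \subset Q).
    apply: contra YQ => sub; rewrite eqEcard sub Qcard -rab.
    by rewrite (eqP Yc) leqnn.
  have yP : y \in P by have := subsetP YPQ _ yY; rewrite inE (negPf yQ) orbF.
  have fy : fill (w a) (P :|: Q) Y w y = (w y).+1.
    by rewrite ffunE inE yP yY; move: yP; rewrite inE => /andP[/eqP->].
  have neq : w <> fill (w a) (P :|: Q) Y w.
    by move=> /(congr1 (fun u : word => u y)); rewrite fy; lia.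
  case: (lexlt_total neq) => // -[c ltc hi]; exfalso.
  have cQ : c \in Q.
    move: ltc; rewrite ffunE; case: ifP; last by rewrite ltnn.
    rewrite !inE => /orP[/andP[/eqP-> _]|-> //]; case: ifP; rewrite ?ltnn //; lia.
  have : (c < y)%N.
    move: yP cQ; rewrite !inE => /andP[_ ay] /andP[_ cb].
    exact: leq_ltn_trans cb (leq_trans ba ay).
  by move=> /hi; rewrite fy; lia.
move=> /eqP; apply/negP; rewrite (_ : fill _ _ _ _ = w) //.
apply/ffunP => c; rewrite ffunE inE; have [|cP] := boolP (c \in P).
  move=> cP; case: ifP => [cQ|_]; first by case: (PQ c).
  by move: cP; rewrite inE => /andP[/eqP].
rewrite /=; have [cQ|//] := boolP (c \in Q); move: (cQ); rewrite inE => /andP[/eqP-> _].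
by rewrite wb.
Qed.

(** If Z has more positions than row i has boxes, this is the two-row relation.
Otherwise raising j positions of Z leaves too few letters i. *)
Lemma polytabloid_james_kernel x :
  james_kernel (wcomb (x * colsum (colword T)) (rowword T)).
Proof.
move=> i Z w j lt_in wZ j0; set f := wcomb _ _.
have fl v : f v != 0 -> occ v i = part nu i.
  by move=> /occ_wcomb ->; rewrite occ_rowword.
have [le|gt] := leqP #|Z| (part nu i).
  apply: big1 => Y /andP[YZ /eqP Yj]; apply/eqP; apply: contraT => /fl.
  rewrite (_ : occ _ _ = #|Z :\: Y|).
    by rewrite cardsDS //; have := subset_leq_card YZ; lia.
  apply: eq_card => a; rewrite !inE ffunE.
  case: ifPn => [aZ|/wZ/negPf->]; rewrite ?andbF //.
  by case: ifP; rewrite ?eqxx //= gtn_eqF.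
have : two_row_relation f i (part nu i).
  apply: two_row_relation_colsum => a; rewrite !ffunE => -[<-|ra].
    exact: col_lt_part.
  apply: leq_trans (col_lt_part _) _; apply: part_le; rewrite ra; lia.
move=> /(_ set0 Z w (fun k => (k == j)%:R)); rewrite setD0 => /(_ gt).
move=> e; rewrite big_mkcondr -[RHS]e; apply: eq_bigr => Y _.
rewrite (_ : blank _ _ = fill i Z Y w); last first.
  by apply/ffunP => a; rewrite ffunE inE.
by case: eqP; rewrite ?mul1r ?mul0r.
Qed.

(** Integral form of James's kernel intersection theorem: descending induction on
the largest word in the support, whose coefficient is removed by a polytabloid
with leading coefficient 1. *)
Lemma james_kernel_polytabloids f : (forall w, f w != 0 -> has_content w) ->
  james_kernel f ->
  exists z, forall w, f w = wcomb (z * colsum (colword T)) (rowword T) w.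
Proof.
have [D HD] : exists D, forall w, has_content w -> (weight w < D)%N.
  exists (\sum_(a < n) n * n.+1 ^ a).+1%N => w wnu; rewrite ltnS.
  apply: leq_sum => a _; rewrite leq_mul2r; apply/orP; right.
  exact: ltnW (content_bound a wnu).
move=> fc; have : forall w, f w != 0 -> (weight w < D)%N by move=> w /fc/HD.
elim: D f fc {HD} => [|D IHD] f fc fD f0.
  exists 0 => w; rewrite mul0r wcomb0; apply/eqP; apply: contraT => /fD.
  by rewrite ltn0.
have [[w fw wD]|none] := pselect (exists2 w, f w != 0 & weight w = D); last first.
  apply: IHD => // w fw; have := fD w fw; rewrite ltnS leq_eqVlt.
  by case/orP => // /eqP wD; case: none; exists w.
have wnu := fc w fw.
have cs : column_strict w.
  apply: (james_kernel_leading f0 wnu _ fw) => v fv /(weight_lt wnu).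
  by have := fD v fv; rewrite wD; lia.
have [x [ew elex]] := leading_polytabloid wnu cs.
set e := wcomb _ _ in ew elex.
pose f' v := f v - f w * e v.
have f'c v : f' v != 0 -> has_content v.
  rewrite /f'; have [->|/fc//] := eqVneq (f v) 0.
  rewrite sub0r oppr_eq0 mulf_eq0 => /norP[_ /wcomb_orbit[g ->]].
  exact: has_content_wact.
have f'D v : f' v != 0 -> (weight v < D)%N.
  move=> nz; have [ev|ev] := eqVneq (e v) 0.
    have fv : f v != 0 by move: nz; rewrite /f' ev mulr0 subr0.
    have := fD v fv; rewrite ltnS leq_eqVlt => /orP[/eqP vD|//].
    have [vw|neq] := pselect (v = w); first by move: ev; rewrite vw ew.
    by case: (lexlt_total neq) => /weight_lt; rewrite vD wD ltnn => ->//; apply: fc.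
  case: (elex _ ev) => [vw|/weight_lt]; last by rewrite wD; apply; apply: f'c.
  by move: nz; rewrite vw /f' ew mulr1 subrr eqxx.
have [|z zE] := IHD f' f'c f'D.
  move=> i Z u j lt_in uZ j0; rewrite /f' sumrB f0 // -big_distrr /=.
  by rewrite polytabloid_james_kernel // mulr0 subrr.
exists (z + x *~ f w) => v; rewrite mulrDl wcombD -zE mulrzAl wcombMz /f'.
by rewrite -mulrzr intz mulrC -/e; lia.
Qed.
End Standard.

(** * Polytabloids with a horizontal strip of infinite letters *)

Section PolAction.
Local Open Scope ring_scope.
Variable n : nat.
Implicit Types (f : word n -> int) (w : word n) (g : 'S_n).

Lemma spread_wact f g w : spread f (wact g w) = spread (fun v => f (wact g v)) w.
Proof.
rewrite /spread (reindex_inj (imset_inj (@perm_inj _ g^-1))).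
apply: eq_bigr => X _ /=; congr f; apply/ffunP => a; rewrite !ffunE.
by rewrite -{1}(permK g a) mem_imset //; apply: perm_inj.
Qed.

Lemma eq_spread f f' w : f =1 f' -> spread f w = spread f' w.
Proof. by move=> e; apply: eq_bigr. Qed.

Lemma spread_wcombM z x rho w :
  spread (wcomb (z * x) rho) w = \sum_g z g * spread (wcomb x rho) (wact g^-1 w).
Proof.
under [RHS]eq_bigr do rewrite spread_wact big_distrr /=.
by rewrite [RHS]exchange_big; apply: eq_bigr => X _; rewrite wcombM.
Qed.

(** For a word of content nu this is the sum of i * nu_i, the statistic that orders
the filtration. *)
Definition height w := (\sum_a w a)%N.

Lemma height_wact g w : height (wact g w) = height w.
Proof.
rewrite /height [RHS](reindex_inj (@perm_inj _ g)).
by apply: eq_bigr => a _; rewrite ffunE.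
Qed.
Lemma spread_colsum_eq0 (kap rho w : word n) a b : a != b ->
    kap a = kap b -> w a = w b ->
  spread (wcomb (colsum kap) rho) w = 0.
Proof.
move=> ab kab wab.
have /eqP ws : wact (tperm a b) w == w by have := tperm_wstab wab; rewrite inE.
have : spread (wcomb (colsum kap) rho) w = - spread (wcomb (colsum kap) rho) w.
  rewrite -{1}ws spread_wact /spread -sumrN; apply: eq_bigr => X _.
  by rewrite wcomb_colsum_anti ?tperm_wstab // odd_tperm ab expr1 mulN1r.
lia.
Qed.

End PolAction.

Section Young.
Variables (t n : nat) (lt_tn : (t < n)%N).
Let le_tn := ltnW lt_tn.

Definition lpos (j : 'I_t) : 'I_n := cast_ord (subnKC le_tn) (lshift (n - t) j).
Definition rpos (k : 'I_(n - t)) : 'I_n := cast_ord (subnKC le_tn) (rshift t k).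

Lemma lpos_inj : injective lpos.
Proof. by move=> i j /cast_ord_inj/lshift_inj. Qed.
Lemma rpos_inj : injective rpos.
Proof. by move=> i j /cast_ord_inj/rshift_inj. Qed.
Lemma lrpos j k : lpos j <> rpos k.
Proof. by move=> /cast_ord_inj/eqP; rewrite eq_lrshift. Qed.

Variant pos_spec : 'I_n -> Type :=
  | LPos j : pos_spec (lpos j)
  | RPos k : pos_spec (rpos k).
Lemma posP a : pos_spec a.
Proof.
rewrite -(cast_ordKV (subnKC le_tn) a).
move: (cast_ord (esym (subnKC le_tn)) a) => c.
by case: (split_ordP c) => j ->; [apply: LPos|apply: RPos].
Qed.

Lemma young_lpos p j : young_perm le_tn p (lpos j) = lpos (p.1 j).
Proof.
rewrite /young_perm cast_permE cast_ordK permE /young_fun.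
by rewrite (unsplitK (inl _)).
Qed.
Lemma young_rpos p k : young_perm le_tn p (rpos k) = rpos (p.2 k).
Proof.
rewrite /young_perm cast_permE cast_ordK permE /young_fun.
by rewrite (unsplitK (inr _)).
Qed.

Definition extend (w : word t) (r : 'I_(n - t) -> nat) : word n :=
  [ffun a => match split (cast_ord (esym (subnKC le_tn)) a) with
             | inl j => w j | inr k => r k end].
Lemma extend_lpos w r j : extend w r (lpos j) = w j.
Proof. by rewrite ffunE /lpos cast_ordK (unsplitK (inl _)). Qed.
Lemma extend_rpos w r k : extend w r (rpos k) = r k.
Proof. by rewrite ffunE /rpos cast_ordK (unsplitK (inr _)). Qed.

Variables (la : intpart t) (T : tableau la).

(** The tableau T on the first t positions.  The other positions carry infinity,
and each of them is a column by itself, so that there is no antisymmetrization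
there. *)
Definition rho0 : word n := extend (rowword T) (fun=> n).
Definition kap0 : word n := extend (colword T) (fun k => n + k)%N.

Lemma occ_rho0 i : (i < n)%N -> occ rho0 i = part la i.
Proof.
move=> lt_in; rewrite -(occ_rowword T) /occ -[RHS](card_imset _ lpos_inj).
apply: eq_card => a; rewrite !inE; case: (posP a) => j.
  by rewrite extend_lpos mem_imset ?inE //; apply: lpos_inj.
rewrite extend_rpos (gtn_eqF lt_in); apply/esym/imsetP => -[k _] /esym.
exact: lrpos.
Qed.

Lemma colword_bound j : (colword T j < n)%N.
Proof.
rewrite ffunE; apply: leq_trans (col_lt_part _) _.
rewrite -(occ_rowword T); apply: leq_trans (max_card _) _.
by rewrite card_ord.
Qed.

Lemma rho0_two_row i (z : group_ring 'S_n) : (i.+1 < n)%N ->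
  two_row_relation (wcomb (z * colsum kap0)%R rho0) i (part la i).
Proof.
move=> lt_in; apply: two_row_relation_colsum => a; case: (posP a) => j.
  rewrite !extend_lpos !ffunE => -[<-|ra]; first exact: col_lt_part.
  by apply: leq_trans (col_lt_part _) _; apply: part_le; rewrite ra.
rewrite extend_rpos; lia.
Qed.

Variables (nu : intpart n) (Tn : tableau nu).
Hypothesis la_le_nu : forall i, (part la i <= part nu i)%N.
Hypothesis nu_le_la : forall i, (part nu i.+1 <= part la i)%N.

Definition in_la a := (colword Tn a < part la (rowword Tn a))%N.
(** The shape nu with infinity in the boxes outside la. *)
Definition hrow : word n := [ffun a => if in_la a then rowword Tn a else n].

Let same_box a (j : 'I_t) :=
  (rowword T j == rowword Tn a) && (colword T j == colword Tn a).

Let same_box_in a : in_la a -> exists j, same_box a j.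
Proof.
move=> /box_exists [b [rb cb]]; exists (T b).
by rewrite /same_box -rb -cb [rowword T _]ffunE [colword T _]ffunE fillK !eqxx.
Qed.

Let in_same_box a j : same_box a j -> in_la a.
Proof. by rewrite /in_la => /andP[/eqP<- /eqP<-]; rewrite !ffunE col_lt_part. Qed.

Let Out := [set a | ~~ in_la a].
Let card_out : (#|Out| <= n - t)%N.
Proof.
have ex j : {a | same_box a j}.
  apply: sigW; have : (colword T j < part nu (rowword T j))%N.
    by rewrite !ffunE; apply: leq_trans (col_lt_part _) (la_le_nu _).
  move=> /box_exists[b [rb cb]]; exists (Tn b).
  by rewrite /same_box [rowword Tn _]ffunE [colword Tn _]ffunE fillK rb cb !eqxx.
have inj : injective (fun j => sval (ex j)).
  move=> i j /= eij; have /andP[/eqP ri /eqP ci] := svalP (ex i).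
  have /andP[/eqP rj /eqP cj] := svalP (ex j).
  by apply: (@rowcol_inj _ _ T); rewrite ?ri ?rj ?ci ?cj eij.
have : (#|[set: 'I_t]| <= #|~: Out|)%N.
  rewrite -(card_imset _ inj); apply: subset_leq_card; apply/subsetP => a.
  case/imsetP => j _ ->; rewrite !inE negbK.
  exact: in_same_box (svalP (ex j)).
by rewrite cardsT card_ord; have := cardsC Out; rewrite card_ord; lia.
Qed.

Let out_rank (a : 'I_n) := #|[set b in Out | (b < a)%N]|.
Let sub_gt0 : (0 < n - t)%N. Proof. by rewrite subn_gt0. Qed.
Let out_pos (a : 'I_n) : 'I_(n - t) := insubd (Ordinal sub_gt0) (out_rank a).

Let out_posE a : a \in Out -> out_pos a = out_rank a :> nat.
Proof.
move=> aO; rewrite /out_pos val_insubd ifT //.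
apply: leq_trans card_out; apply: proper_card; apply/properP; split.
  by apply/subsetP => b; rewrite inE => /andP[].
by exists a => //; rewrite inE ltnn andbF.
Qed.

Let out_pos_inj : {in Out &, injective out_pos}.
Proof.
have mono (a b : 'I_n) : a \in Out -> (a < b)%N -> (out_rank a < out_rank b)%N.
  move=> aO ab; apply: proper_card; apply/properP; split.
    by apply/subsetP => c; rewrite !in_set => /andP[-> /ltn_trans->].
  by exists a; rewrite inE ?aO ?ab // ltnn andbF.
move=> a b aO bO /(congr1 val); rewrite /= !out_posE // => e.
apply: val_inj; case: (ltngtP a b) => // ab.
  by have := mono _ _ aO ab; rewrite e ltnn.
by have := mono _ _ bO ab; rewrite e ltnn.
Qed.

Lemma horizontal_perm : exists g, [/\ wact g rho0 = hrow,
  forall a, in_la a -> wact g kap0 a = colword Tn a &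
  forall a, ~~ in_la a -> exists k, g a = rpos k].
Proof.
pose F a := if [pick j | same_box a j] is Some j then lpos j else rpos (out_pos a).
have outP a : same_box a =1 xpred0 -> a \in Out.
  move=> none; rewrite inE; apply/negP => /same_box_in[j].
  by rewrite none.
have Finj : injective F.
  move=> a b; rewrite /F; case: pickP => [j /andP[/eqP ja /eqP ca]|/outP aO];
     case: pickP => [k /andP[/eqP kb /eqP cb]|/outP bO].
  - by move=> /lpos_inj jk; apply: (@rowcol_inj _ _ Tn); rewrite -?ja -?ca jk.
  - by move=> /lrpos.
  - by move=> /esym/lrpos.
  - by move=> /rpos_inj/out_pos_inj; apply.
exists (perm Finj); split.
- apply/ffunP => a; rewrite ffunE permE /F [RHS]ffunE; case: pickP => [j jP|/outP].
    by rewrite extend_lpos (in_same_box jP); case/andP: jP => /eqP.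
  by rewrite inE extend_rpos => /negPf->.
- move=> a ain; rewrite ffunE permE /F; case: pickP => [j /andP[_ /eqP jP]|/outP].
    by rewrite extend_lpos.
  by rewrite inE ain.
move=> a aout; rewrite permE /F; case: pickP => [j /in_same_box|_].
  by rewrite (negPf aout).
by exists (out_pos a).
Qed.

(** The columns of the generator, transported to nu, refine the columns of nu, so
the antisymmetrizer of nu factors through that of the generator. *)
Lemma horizontal_comb : exists y,
  wcomb (colsum (colword Tn)) hrow = wcomb (y * colsum kap0)%R rho0.
Proof.
have [g [gr gin gout]] := horizontal_perm.
have kout a : ~~ in_la a -> (n <= wact g kap0 a)%N.
  by move=> /gout[k gk]; rewrite ffunE gk extend_rpos leq_addr.
have kin a : in_la a -> (wact g kap0 a < n)%N.
  move=> ain; rewrite gin //; rewrite !ffunE.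
  apply: leq_trans (col_lt_part _) _; rewrite -(occ_rowword Tn).
  by apply: leq_trans (max_card _) _; rewrite card_ord.
have [|x xE] := @colsum_factor _ (colword Tn) (wact g kap0).
  apply/subsetP => s; rewrite !inE => /eqP/ffunP sP; apply/eqP/ffunP => a.
  rewrite ffunE; have := sP a; rewrite ffunE => e.
  have [ain|aout] := boolP (in_la a).
    have sain : in_la (s a).
      by apply/negPn/negP => /kout; rewrite e leqNgt kin.
    by rewrite -gin // e gin.
  have saout : ~~ in_la (s a) by apply/negP => /kin; rewrite e ltnNge kout.
  have [k gk] := gout _ aout; have [k' gk'] := gout _ saout.
  move: e; rewrite ![wact _ _ _]ffunE gk gk' !extend_rpos => /addnI/val_inj kk.
  by have -> : s a = a by apply: (@perm_inj _ g); rewrite gk gk' kk.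
exists (x * gr_elt g)%R; apply: funext => w.
by rewrite xE -gr wcomb_wact -!mulrA colsum_wact.
Qed.

(** Let w have distinct letters in each column.  The letters replacing infinity at
the foot of a column of nu cannot be among those above, so they are at least the
row index; the bound on the height forces equality everywhere.  If w has a
repeated letter in some column, both sides vanish by antisymmetry. *)
Lemma spread_horizontal (w : word n) : (forall a, w a < n)%N ->
    (height w <= height (rowword Tn))%N ->
  spread (wcomb (colsum (colword Tn)) hrow) w
    = wcomb (colsum (colword Tn)) (rowword Tn) w.
Proof.
move=> wn hw.
have [[a b] /= /and3P[ab /eqP cab /eqP wab]|inj] :=
  pickP (fun ab : 'I_n * 'I_n =>
    [&& ab.1 != ab.2, colword Tn ab.1 == colword Tn ab.2 & w ab.1 == w ab.2]).
  by rewrite (spread_colsum_eq0 _ ab) // (wcomb_colsum_eq0 _ ab).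
rewrite /spread /wcomb.
under eq_bigr do rewrite big_mkcond /=.
rewrite exchange_big [RHS]big_mkcond /=; apply: eq_bigr => h _.
have [hs|hs] := boolP (h \in wstab (colword Tn)); last first.
  rewrite colsumE (negPf hs) mul0r if_same big1 // => X _.
  by rewrite if_same.
pose X0 := [set a | wact h hrow a == n].
have hX X : wact h hrow = blank X w -> X = X0.
  move=> e; apply/setP => a; rewrite inE e ffunE.
  by case: ifP; rewrite ?eqxx // (ltn_eqF (wn a)).
rewrite (bigD1 X0) //= big1 ?addr0 => [|X XX0]; last first.
  by case: eqP => // /hX e; rewrite e eqxx in XX0.
congr (if _ then _ else _); apply/eqP/eqP => [e|e]; last first.
  apply/ffunP => a; rewrite [RHS]ffunE inE; case: eqP => [//|].
  by rewrite -e ![wact h _ a]ffunE [hrow _]ffunE; case: ifP.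
pose u := wact h^-1 w.
have uin a : in_la a -> u a = rowword Tn a.
  move=> ain; have := congr1 (fun v : word n => v (h^-1 a)%g) e.
  rewrite /u !ffunE inE !ffunE permKV ain.
  by case: eqP => // eqn; have := content_bound (nu := nu) a (has_content_wact Tn 1);
    rewrite wact1 ffunE eqn ltnn.
have ge a : (rowword Tn a <= u a)%N.
  have [/uin->//|aout] := boolP (in_la a); rewrite leqNgt; apply/negP => lt.
  have [|B [Br Bc]] := @box_exists _ nu (u a) (colword Tn a).
    apply: leq_trans (part_le nu (ltnW lt)); rewrite !ffunE; exact: col_lt_part.
  have Bin : in_la (Tn B).
    rewrite /in_la [colword _ _]ffunE [rowword _ _]ffunE fillK Br Bc.
    apply: leq_trans (nu_le_la _); apply: leq_trans (part_le nu lt).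
    by rewrite !ffunE; exact: col_lt_part.
  have := inj ((h^-1)%g a, (h^-1)%g (Tn B)); rewrite /= => /and3P[]; split.
  - rewrite (inj_eq (@perm_inj _ _)); apply: contraNneq aout => ->//.
  - have hV : (h^-1)%g \in wstab (colword Tn) by rewrite groupV.
    move: hV; rewrite inE => /eqP/ffunP hV.
    have := hV a; have := hV (Tn B); rewrite ffunE => -> ; rewrite ffunE => ->.
    by rewrite [colword Tn (Tn B)]ffunE fillK Bc.
  - have := uin _ Bin; rewrite /u [wact _ _ _]ffunE => ->.
    by rewrite [rowword _ _]ffunE fillK Br /u ffunE.
have uE : u = rowword Tn.
  apply/ffunP => a; apply/eqP; rewrite eqn_leq ge andbT leqNgt; apply/negP => lt.
  move: hw; rewrite -(height_wact h^-1 w) -/u leqNgt => /negP[].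
  rewrite /height (bigD1 a) //= [X in (_ < X)%N](bigD1 a) //=.
  by rewrite -addSn leq_add // leq_sum.
by rewrite -uE /u wactKV.
Qed.
End Young.

(** * Contents that can survive spreading *)

Lemma intpart_exists n (p : nat -> nat) : (forall i, p i.+1 <= p i)%N ->
    (forall i, n <= i -> p i = 0)%N -> (\sum_(i < n) p i = n)%N ->
  exists mu : intpart n, forall i, part mu i = p i.
Proof.
move=> mono p0 psum.
have le i j : (i <= j)%N -> (p j <= p i)%N.
  elim: j => [|j IHj]; first by rewrite leqn0 => /eqP->.
  rewrite leq_eqVlt => /orP[/eqP->//|]; rewrite ltnS => /IHj; exact: leq_trans.
have ex0 : exists i, p i == 0%N by exists n; rewrite p0.
case: (ex_minnP ex0) => m /eqP pm mmin.
have mn : (m <= n)%N by apply: mmin; rewrite p0.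
have pos i : (i < m)%N -> (0 < p i)%N.
  by rewrite ltnNge lt0n; apply: contra => /mmin.
have zero i : (m <= i)%N -> p i = 0%N by move=> /le; rewrite pm leqn0 => /eqP.
have ok : is_partition n (mkseq p m).
  apply/and3P; split.
  - apply/(sortedP 0%N) => i; rewrite size_mkseq => im.
    by rewrite !nth_mkseq ?(ltnW im) //=; apply: mono.
  - apply/negP => /mapP[i]; rewrite mem_iota add0n => /andP[_ /pos]; lia.
  rewrite sumnE big_map -[m in iota 0 m]subn0 -/(index_iota 0 m).
  apply/eqP; rewrite -psum -(big_mkord xpredT) [RHS](@big_cat_nat _ _ _ m) //=.
  rewrite [X in (_ + X)%N]big_nat_cond [X in (_ + X)%N]big1 ?addn0 // => i.
  by move=> /andP[/andP[/zero ->]].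
exists (IntPart ok) => i; rewrite /part /=.
have [im|mi] := ltnP i m; first by rewrite nth_mkseq.
by rewrite nth_default ?size_mkseq // zero.
Qed.

Section Heights.
Variable n : nat.
Local Notation word := (word n).
Implicit Types (w : word) (Y Z : {set 'I_n}).

Lemma occE w k : occ w k = (\sum_a (w a == k))%N.
Proof.
rewrite /occ -sum1_card big_mkcond; apply: eq_bigr => a _.
by rewrite inE; case: eqP.
Qed.

Lemma height_occ w : (forall a, w a < n)%N ->
  height w = (\sum_(i < n) i * occ w i)%N.
Proof.
move=> wn; rewrite /height.
under [RHS]eq_bigr do rewrite occE big_distrr /=.
rewrite exchange_big; apply: eq_bigr => a _ /=.
rewrite (bigD1 (Ordinal (wn a))) //= eqxx muln1 big1 ?addn0 // => i.
by rewrite eq_sym -val_eqE /= => /negPf->; rewrite muln0.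
Qed.

Lemma sum_occ w : (forall a, w a < n)%N -> (\sum_(i < n) occ w i = n)%N.
Proof.
move=> wn; under eq_bigr do rewrite occE.
rewrite exchange_big /= -[RHS]card_ord -sum1_card; apply: eq_bigr => a _.
rewrite (bigD1 (Ordinal (wn a))) //= eqxx big1 // => i.
by rewrite eq_sym -val_eqE /= => /negPf->.
Qed.

Lemma fill_set0 i Z Y w a : Y \subset Z ->
  fill i Z Y w a = (fill i Z set0 w a + (a \in Y))%N.
Proof.
move=> YZ; rewrite !ffunE inE; case: ifPn => aZ.
  by case: (a \in Y); rewrite ?addn1 ?addn0.
by rewrite (contraNF (subsetP YZ a) aZ) addn0.
Qed.

Lemma height_fill i Z Y w : Y \subset Z ->
  height (fill i Z Y w) = (height (fill i Z set0 w) + #|Y|)%N.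
Proof.
move=> YZ; rewrite /height -sum1_card [X in (_ + X)%N]big_mkcond -big_split.
by apply: eq_bigr => a _; rewrite fill_set0 //=; case: (a \in Y).
Qed.

Lemma occ_fill i Z Y w k : Y \subset Z ->
  (occ (fill i Z Y w) k + (k == i) * #|Y|
     = occ (fill i Z set0 w) k + (k == i.+1) * #|Y|)%N.
Proof.
move=> YZ; rewrite !occE -sum1_card (big_mkcond (mem Y)) /=.
rewrite !big_distrr -!big_split; apply: eq_bigr => a _ /=.
have [aY|aY] := boolP (a \in Y); last by rewrite fill_set0 // (negPf aY) !muln0 !addn0.
rewrite !ffunE inE (subsetP YZ) // aY !muln1 addnC eq_sym.
by congr addn; rewrite eq_sym.
Qed.
End Heights.

Section Kernel.
Local Open Scope ring_scope.
Variables (t n : nat) (lt_tn : (t < n)%N) (la : intpart t).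
Local Notation word := (word n).
Implicit Types (w : word) (mu nu : intpart n).

Definition content_height mu := (\sum_(i < n) i * part mu i)%N.

Lemma height_content mu w : has_content mu w -> height w = content_height mu.
Proof.
move=> wmu; rewrite height_occ => [|a]; last exact: content_bound wmu.
by apply: eq_bigr => i _; rewrite wmu.
Qed.

Lemma interlacing_le mu : interlacing la mu -> forall i, (part la i <= part mu i)%N.
Proof.
move=> /andP[/forallP H _] i; have [lt_in|ni] := ltnP i n.
  exact: (H (Ordinal lt_in)).
by rewrite part_size // (leq_trans (ltnW lt_tn)).
Qed.
Lemma interlacing_ge mu : interlacing la mu -> forall i, (part mu i.+1 <= part la i)%N.
Proof.
move=> /andP[_ /forallP H] i; have [lt_in|ni] := ltnP i n.-1.
  exact: (H (Ordinal lt_in)).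
by rewrite part_size //; lia.
Qed.

Variable f : word -> int.
Hypothesis f_rel : forall i, (i.+1 < n)%N -> two_row_relation f i (part la i).
Hypothesis f_occ : forall v i, f v != 0 -> (i < n)%N -> occ v i = part la i.

(** Induction on the height of w.  A content with fewer than la_i letters i never
occurs, as blanking only removes letters.  If i + 1 occurs more than la_i times,
lowering any nonempty subset of these letters to i gives a smaller height, so
the alternating sum reduces to the single term w.  All other contents interlace
with la. *)
Lemma spread_vanish d :
  (forall mu, interlacing la mu ->
    forall w, has_content mu w -> (height w < d)%N -> spread f w = 0) ->
  forall w, (forall a, w a < n)%N -> (height w < d)%N -> spread f w = 0.
Proof.
move=> H w wn wd; move e : (height w) => k.
elim/ltn_ind: k w wn wd e => k IHk w wn wd wk.
have [/forallP/= le_w|] := boolP [forall i : 'I_n, part la i <= occ w i]%N; last first.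
  rewrite negb_forall => /existsP[i]; rewrite -ltnNge => lt.
  apply: big1 => X _; apply/eqP; apply: contraTT lt => /f_occ/(_ (ltn_ord i)) <-.
  rewrite -leqNgt; apply: subset_leq_card; apply/subsetP => a; rewrite !inE ffunE.
  by case: ifP => // _ /eqP ni; have := ltn_ord i; rewrite -ni ltnn.
have [/forallP/= ge_w|] := boolP [forall i : 'I_n.-1, occ w i.+1 <= part la i]%N; last first.
  rewrite negb_forall => /existsP[i]; rewrite -ltnNge => lt.
  have lt_in : (i.+1 < n)%N by have := ltn_ord i; lia.
  pose Z := [set a | w a == i.+1].
  have wE : fill i Z Z w = w.
    apply/ffunP => a; rewrite ffunE; case: ifP => [aZ|_ //]; rewrite aZ.
    by move: aZ; rewrite inE => /eqP.
  have := spread_alternating w (f_rel lt_in) (lt : (_ < #|Z|)%N).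
  rewrite (bigD1 Z) //= wE big1 ?addr0 => [|Y /andP[YZ neqY]].
    by move/eqP; rewrite mulf_eq0 signr_eq0 => /eqP.
  have YltZ : (#|Y| < #|Z|)%N by apply: proper_card; rewrite properEneq neqY.
  have hY : (height (fill i Z Y w) < k)%N.
    by rewrite -wk -{2}wE (height_fill i w YZ) (height_fill i w (subxx Z)) ltn_add2l.
  rewrite (IHk _ hY) ?mulr0 //; last by apply: ltn_trans hY _; rewrite -wk.
  move=> a; rewrite ffunE; case: ifP => // _; case: ifP => // _; exact: ltnW.
have [i||mu muE] := @intpart_exists n (occ w) _ _ (sum_occ wn).
- have [lt|ni] := ltnP i n.-1.
    have lt_in : (i < n)%N by lia.
    exact: leq_trans (ge_w (Ordinal lt)) (le_w (Ordinal lt_in)).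
  rewrite (_ : occ w i.+1 = 0%N) //; apply/eqP; rewrite cards_eq0.
  apply/set0Pn => -[a]; rewrite inE => /eqP wa; have := wn a; lia.
- move=> i ni; apply/eqP; rewrite cards_eq0; apply/set0Pn => -[a].
  rewrite inE => /eqP wa; have := wn a; lia.
apply: (H mu) => //; apply/andP; split; apply/forallP => i; rewrite muE //.
Qed.

(** Lowering the j > 0 letters i + 1 of Z gives a word of smaller height, where the
function vanishes; the right-hand side of [spread_two_row] is a multiple of its
value there. *)
Lemma spread_james_kernel nu : interlacing la nu ->
  (forall mu, interlacing la mu -> (content_height mu < content_height nu)%N ->
    forall w, has_content mu w -> spread f w = 0) ->
  james_kernel (fun w => if `[< has_content nu w >] then spread f w else 0).
Proof.
move=> nuP H i Z w j lt_in wZ j0.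
have [/existsP[Y /and3P[YZ Yj /asboolP Ynu]]|none] := boolP [exists Y : {set 'I_n},
   [&& Y \subset Z, #|Y| == j & `[< has_content nu (fill i Z Y w) >]]]; last first.
  apply: big1 => Y /andP[YZ Yj]; case: asboolP => // Ynu.
  case/existsP: none; exists Y; rewrite YZ Yj; exact/asboolP.
rewrite (eq_bigr (fun Y => spread f (fill i Z Y w))) => [|Y' /andP[YZ' Yj']]; last first.
  case: asboolP => // -[] k; rewrite -Ynu.
  have := occ_fill i w k YZ; have := occ_fill i w k YZ'.
  rewrite (eqP Yj) (eqP Yj'); lia.
have fi v : f v != 0 -> occ v i = part la i by move=> /f_occ; apply; apply: ltnW.
rewrite (spread_two_row _ (f_rel lt_in) fi (ltnW lt_in) wZ).
have hY := height_fill i w YZ.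
rewrite (spread_vanish (d := content_height nu)) ?mul0rn //.
- by move=> mu mui u umu; rewrite (height_content umu) => lt; apply: (H mu).
- move=> a; have := content_bound a Ynu; rewrite fill_set0 //; lia.
- by rewrite -(height_content Ynu) hY (eqP Yj) -addn1 leq_add2l.
Qed.

Hypothesis f_infty : forall v, f v != 0 -> occ v n = (n - t)%N.
Hypothesis f_bound : forall v, f v != 0 -> forall a, (v a <= n)%N.

(** By [spread_vanish] the spread vanishes at all finite words.  Since t < n, the
letter n - 1 does not occur in la; so if all infinities of v are replaced by
n - 1, then v is the only blanking of the result that can lie in the support. *)
Lemma spread_injective :
  (forall mu, interlacing la mu -> forall w, has_content mu w -> spread f w = 0) ->
  forall v, f v = 0.
Proof.
move=> H v; apply/eqP; apply: contraT => fv.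
have n0 : (n.-1 < n)%N by lia.
have la0 : part la n.-1 = 0%N by apply: part_size; lia.
pose w : word := [ffun a => if v a == n then n.-1 else v a].
have wn a : (w a < n)%N.
  by rewrite ffunE; case: eqP => // vn; have := f_bound fv a; lia.
have : spread f w = 0.
  apply: (spread_vanish (d := (height w).+1)) => // mu mui u umu _; exact: H umu.
pose X0 := [set a | v a == n].
rewrite /spread (bigD1 X0) //= big1 ?addr0 => [|X XX0].
  rewrite (_ : blank _ _ = v); first by move=> fv0; rewrite fv0 eqxx in fv.
  by apply/ffunP => a; rewrite !ffunE inE; case: eqP.
apply/eqP; apply: contraT => fX; case/eqP: XX0.
have eX : X = [set a | blank X w a == n].
  by apply/setP => a; rewrite inE ffunE; case: ifP; rewrite ?eqxx // (ltn_eqF (wn a)).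
apply/esym/eqP; rewrite eqEcard; apply/andP; split.
  apply/subsetP => a; rewrite inE => /eqP va.
  have /eqP := f_occ fX n0; rewrite la0 cards_eq0 => /eqP/setP/(_ a).
  by rewrite !inE !ffunE va eqxx; case: ifP; rewrite ?eqxx.
by rewrite {1}eX; have := f_infty fX; have := f_infty fv; rewrite /occ => -> ->.
Qed.
End Kernel.

(** * Abstract modules, tensors and Specht classes *)

Section Modules.
Local Open Scope ring_scope.
Local Open Scope quotient_scope.

(** Maps out of a quotient and onto another quotient are most easily described on
representatives; a linear relation between the two spares the choice of
representatives and the proof that it does not matter. *)
Lemma isomorphic_of_rel (R : pzRingType) (V W : lmodType R) (r : V -> W -> Prop) :
  (forall v, exists w, r v w) -> (forall w, exists v, r v w) ->
  (forall a v v' w w', r v w -> r v' w' -> r (a *: v + v') (a *: w + w')) ->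
  (forall w, r 0 w -> w = 0) -> (forall v, r v 0 -> v = 0) ->
  isomorphic V W.
Proof.
move=> totl totr lin r0 r0'.
have rB v v' w w' : r v w -> r v' w' -> r (v - v') (w - w').
  by move=> vw vw'; have := lin (-1) _ _ _ _ vw' vw; rewrite !scaleN1r ![- _ + _]addrC.
have [f fP] := choice totl; have [g gP] := choice totr.
have funl v w : r v w -> w = f v.
  by move=> /rB /(_ (fP v)); rewrite subrr => /r0/eqP; rewrite subr_eq0 => /eqP.
have funr v w : r v w -> v = g w.
  by move=> /rB /(_ (gP w)); rewrite subrr => /r0'/eqP; rewrite subr_eq0 => /eqP.
have flin : linear f by move=> a u v; apply/esym/funl/lin.
pose fL : {linear V -> W} := HB.pack f (GRing.isLinear.Build _ _ _ _ f flin).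
exists fL; exists g => [v|w] /=; first by apply/esym/funr.
by apply/esym/funl.
Qed.

Lemma tensor_ind (A B : zmodType) (S : Type) ra la (P : @tensor A B S ra la -> Prop) :
  (forall x y, P x -> P y -> P (x - y)) -> (forall a b, P (tens ra la a b)) ->
  forall x, P x.
Proof.
move=> PB Pt.
have P0 : P 0 by rewrite -(subrr (tens ra la 0 0)); apply: PB.
have PN x : P x -> P (- x) by rewrite -sub0r; apply: PB.
have PD x y : P x -> P y -> P (x + y).
  by move=> Px /PN Py; rewrite -[y]opprK; apply: PB.
have Pg (k : int) a b : P (\pi_(tensor ra la) [freeg [:: (k, (a, b))]]).
  have Pn n : P (\pi_(tensor ra la) [freeg [:: (n%:Z, (a, b))]]).
    elim: n => [|n IHn]; first by rewrite freegU0 tensor_pi0.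
    by rewrite -addn1 PoszD -freegUD tensor_piD; apply: PD (Pt a b).
  by case: k => n; rewrite ?NegzE -?freegUN ?tensor_piN; [|apply: PN].
elim/quotW => x; rewrite -(freeg_sumE x).
elim: (dom x) => [|[a b] s IHs]; first by rewrite big_nil tensor_pi0.
by rewrite big_cons tensor_piD; apply: PD.
Qed.

Section SpechtClass.
Variables (n : nat) (nu : intpart n) (T : tableau nu) (m : nat).
Implicit Types (x y z : group_ring 'S_n).

Lemma specht_valMn (u : specht T) k : submod_val (u *+ k) = submod_val u *+ k.
Proof. by elim: k => [|k IHk]; rewrite ?mulr0n // !mulrS -IHk. Qed.

Fact specht_gen_in z :
  (z * col_sum T * row_sum T : (group_ring 'S_n)^o) \in specht_ideal T.
Proof. by apply/asboolP; exists z. Qed.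
Definition specht_gen z : specht T := Submod (specht_gen_in z).

Definition specht_cls z : mod_mult (specht T) m :=
  \pi_(mod_mult (specht T) m) (specht_gen z).

Lemma specht_cls_surj v : exists z, v = specht_cls z.
Proof.
elim/quotW: v => -[s sP]; have /asboolP[z e] := sP; exists z.
by congr (\pi _); apply: val_inj.
Qed.

Lemma specht_clsD y z : specht_cls (y + z) = specht_cls y + specht_cls z.
Proof.
rewrite /specht_cls -[RHS]quotmod_piD; congr (\pi _); apply: val_inj => /=.
by rewrite !mulrDl.
Qed.
Lemma specht_clsZ a z : a *: specht_cls z = specht_cls (a * z).
Proof.
rewrite /specht_cls -[LHS]/(quotmod_scale _ _) quotmod_piZ; congr (\pi _).
by apply: val_inj => /=; rewrite -!mulrA.
Qed.

Lemma specht_cls_eq0 z : specht_cls z = 0 <->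
  exists z', z * col_sum T * row_sum T = (z' *+ m) * col_sum T * row_sum T.
Proof.
have gen0 := morph_add0 specht_clsD.
have key : specht_cls z = 0 <->
    specht_gen z - specht_gen 0 \in @multiples _ (specht T) m.
  rewrite -gen0; split=> [/quotmod_eqP//|H]; exact/quotmod_eqP.
rewrite key [X in X \in _](_ : _ = specht_gen z); last first.
  by apply: val_inj => /=; rewrite !mul0r subr0.
split=> [/asboolP[[s sP] /(congr1 val) /= ->]|[z' e]].
  have /asboolP[z' e] := sP; exists z'; rewrite !mulrnAl -e; exact: specht_valMn.
apply/asboolP; exists (specht_gen z'); apply: val_inj => /=.
by rewrite e !mulrnAl [RHS]specht_valMn.
Qed.
End SpechtClass.

(** * The Young subgroup inside the symmetric group *)

Section YoungGroup.
Variables (t n : nat) (lt_tn : (t < n)%N).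
Let le_tn := ltnW lt_tn.
Local Notation e := (young_perm le_tn).
Local Notation yT := ('S_t * 'S_(n - t))%type.
Implicit Types (p q : yT) (g h : 'S_n).

Lemma young_perm_inj : injective e.
Proof.
move=> [s u] [s' u'] E; congr pair; apply/permP => j.
  apply: (@lpos_inj _ _ lt_tn); have := young_lpos lt_tn (s, u) j.
  by rewrite E young_lpos /= => ->.
apply: (@rpos_inj _ _ lt_tn); have := young_rpos lt_tn (s, u) j.
by rewrite E young_rpos /= => ->.
Qed.

Lemma young_perm1 : e 1%g = 1%g.
Proof. by apply: (mulgI (e 1%g)); rewrite -young_permM !mulg1. Qed.
Lemma young_permV p : e p^-1%g = (e p)^-1%g.
Proof. by apply: (mulgI (e p)); rewrite -young_permM !mulgV young_perm1. Qed.

Definition young_group := [set e p | p in [set: yT]].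
Fact young_group_set : group_set young_group.
Proof.
apply/group_setP; split; first by rewrite -young_perm1; apply: imset_f.
by move=> _ _ /imsetP[p _ ->] /imsetP[q _ ->]; rewrite -young_permM; apply: imset_f.
Qed.
Canonical young_group_group := Group young_group_set.

Lemma young_groupP g : reflect (exists p, g = e p) (g \in young_group).
Proof.
by apply: (iffP imsetP) => [[p _ ->]|[p ->]]; [exists p | exists p; rewrite ?inE].
Qed.

(** A permutation preserving the last n - t positions preserves the complement. *)
Lemma mem_young_group g :
  (forall k, exists k', g (rpos lt_tn k) = rpos lt_tn k') -> g \in young_group.
Proof.
move=> gR; have [r rE] := choice gR.
have r_inj : injective r.
  by move=> k k' E; apply: (@rpos_inj _ _ lt_tn); apply: (@perm_inj _ g); rewrite !rE E.
have gL j : exists j', g (lpos lt_tn j) = lpos lt_tn j'.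
  case E: (g (lpos lt_tn j)) / (posP lt_tn (g (lpos lt_tn j))) => [j'|k].
    by exists j'.
  have [r' _ rK] := injF_bij r_inj; exfalso.
  by move: E; rewrite -(rK k) -rE => /perm_inj/lrpos.
have [l lE] := choice gL.
have l_inj : injective l.
  by move=> k k' E; apply: (@lpos_inj _ _ lt_tn); apply: (@perm_inj _ g); rewrite !lE E.
apply/young_groupP; exists (perm l_inj, perm r_inj); apply/permP => a.
case: (posP lt_tn a) => j; first by rewrite young_lpos permE lE.
by rewrite young_rpos permE rE.
Qed.

Lemma sum_young (V : zmodType) (F : 'S_n -> V) :
  \sum_(g in young_group) F g = \sum_p F (e p).
Proof.
rewrite big_imset /=; last by move=> p q _ _ /young_perm_inj.
by apply: eq_bigl => p; rewrite inE.
Qed.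

Variables (la : intpart t) (T : tableau la).

(** The product of x with the sum over the symmetric group of the last n - t
positions. *)
Definition young_ext (x : group_ring 'S_t) : group_ring 'S_n :=
  [ffun g => \sum_(p | e p == g) x p.1].

Lemma young_extE x p : young_ext x (e p) = x p.1.
Proof.
rewrite ffunE (bigD1 p) //= big1 ?addr0 // => q /andP[/eqP/young_perm_inj->].
by rewrite eqxx.
Qed.
Lemma young_ext_out x g : g \notin young_group -> young_ext x g = 0.
Proof.
move=> gE; rewrite ffunE big1 // => p /eqP ep; case/negP: gE.
by apply/young_groupP; exists p.
Qed.

Lemma young_extP (x y : group_ring 'S_n) : (forall p, x (e p) = y (e p)) ->
  (forall g, g \notin young_group -> x g = 0) ->
  (forall g, g \notin young_group -> y g = 0) -> x = y.
Proof.
move=> H x0 y0; apply/ffunP => g; 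
have [/young_groupP[p ->]|gE] := boolP (g \in young_group).
  exact: H.
by rewrite x0 // y0.
Qed.

Lemma young_extD x y : young_ext (x + y) = young_ext x + young_ext y.
Proof.
apply/ffunP => g; rewrite !ffunE -big_split.
by apply: eq_bigr => p _; rewrite ffunE.
Qed.

Lemma young_extM p x :
  gr_elt (e p) * young_ext x = young_ext (gr_elt p.1 * x).
Proof.
apply: young_extP => [q|g gE|g gE].
- by rewrite young_extE !gr_eltMl -young_permV -young_permM young_extE.
- rewrite gr_eltMl young_ext_out // groupMl // groupV.
  by apply/young_groupP; exists p.
exact: young_ext_out.
Qed.

Lemma rho0_infty a : (rho0 lt_tn T a == n) -> exists k, a = rpos lt_tn k.
Proof.
case: (posP lt_tn a) => [j|k _]; last by exists k.
rewrite extend_lpos => /eqP jn.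
have := content_bound (nu := la) j (has_content_wact T 1).
by rewrite wact1 jn; lia.
Qed.

Lemma kap0_stab s : s \in wstab (kap0 lt_tn T) ->
  exists2 s', s' \in wstab (colword T) & s = e (s', 1%g).
Proof.
rewrite inE => /eqP/ffunP sP.
have sR k : s (rpos lt_tn k) = rpos lt_tn k.
  have := sP (rpos lt_tn k); rewrite ffunE extend_rpos.
  case: (posP lt_tn (s (rpos lt_tn k))) => j.
    by rewrite extend_lpos => E; have := colword_bound lt_tn T j; rewrite E; lia.
  by rewrite extend_rpos => /addnI/val_inj->.
have /young_groupP[[s' u] E] : s \in young_group.
  by apply: mem_young_group => k; exists k.
have u1 : u = 1%g.
  apply/permP => k; apply: (@rpos_inj _ _ lt_tn).
  by rewrite perm1 -[RHS]sR E young_rpos.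
exists s'; last by rewrite E u1.
rewrite inE; apply/eqP/ffunP => j; have := sP (lpos lt_tn j).
by rewrite [wact _ _ _]ffunE E young_lpos !extend_lpos [wact _ _ _]ffunE.
Qed.

Lemma kap0_stab_young s : s \in wstab (colword T) ->
  e (s, 1%g) \in wstab (kap0 lt_tn T).
Proof.
rewrite !inE => /eqP/ffunP sP; apply/eqP/ffunP => a; rewrite ffunE.
case: (posP lt_tn a) => j; last by rewrite young_rpos perm1.
by rewrite young_lpos !extend_lpos; have := sP j; rewrite ffunE.
Qed.

Lemma odd_young s : odd_perm (e (s, 1%g)) = odd_perm s.
Proof.
have eM s' s'' : e ((s' * s'')%g, 1%g) = (e (s', 1%g) * e (s'', 1%g))%g.
  rewrite -young_permM; congr (young_perm _ _).
  by rewrite -[RHS]/(s' * s'', 1 * 1)%g mulg1.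
have [ts -> _] := prod_tpermP s.
elim: ts => [|[i j] ts IHts]; first by rewrite big_nil young_perm1 !odd_perm1.
rewrite big_cons eM !odd_permM IHts /=; congr (_ (+) _).
rewrite (_ : e _ = tperm (lpos lt_tn i) (lpos lt_tn j)).
  by rewrite !odd_tperm (inj_eq (@lpos_inj _ _ lt_tn)).
apply/permP => a; case: (posP lt_tn a) => k.
  rewrite young_lpos /=; case: tpermP => [->|->|/eqP ki /eqP kj].
  - by rewrite tpermL.
  - by rewrite tpermR.
  by rewrite tpermD // (inj_eq (@lpos_inj _ _ lt_tn)) eq_sym.
by rewrite young_rpos perm1 tpermD //; apply/eqP/lrpos.
Qed.

Lemma young_ext_rowsum : rowsum (rho0 lt_tn T) = young_ext (row_sum T).
Proof.
rewrite row_sumE; apply: young_extP => [p|g gE|g gE]; last exact: young_ext_out.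
  rewrite young_extE !rowsumE !inE; congr (nat_of_bool _)%:R.
  apply/eqP/eqP => /ffunP pP; apply/ffunP => j.
    have := pP (lpos lt_tn j).
    by rewrite [wact _ _ _]ffunE young_lpos !extend_lpos [wact _ _ _]ffunE.
  rewrite [wact _ _ _]ffunE; case: (posP lt_tn j) => {}j; last first.
    by rewrite young_rpos !extend_rpos.
  by rewrite young_lpos !extend_lpos; have := pP j; rewrite [wact _ _ _]ffunE.
rewrite rowsumE inE; case: eqP => // /ffunP gP; case/negP: gE.
apply: mem_young_group => k; apply: rho0_infty.
by have := gP (rpos lt_tn k); rewrite ffunE extend_rpos => ->.
Qed.

(** The generator of the Specht ideal of la, multiplied by the sum over the second
factor, is the product of the stabilizer sums of the words [kap0] and [rho0]. *)
Lemma young_ext_specht :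
  colsum (kap0 lt_tn T) * rowsum (rho0 lt_tn T) = young_ext (col_sum T * row_sum T).
Proof.
rewrite young_ext_rowsum col_sumE; move: (row_sum T) => r.
rewrite /colsum !big_distrl /= (big_morph young_ext young_extD (morph_add0 young_extD)).
have -> : wstab (kap0 lt_tn T) = [set e (s, 1%g) | s in wstab (colword T)].
  apply/setP => g; apply/idP/imsetP => [/kap0_stab[s sP ->]|[s sP ->]].
    by exists s.
  exact: kap0_stab_young.
rewrite big_imset /= => [|s s' _ _ /young_perm_inj[]//].
apply: eq_bigr => s _; rewrite odd_young.
by case: (odd_perm s);
  rewrite /= ?expr1 ?expr0 ?mulrN1z ?mulr1z ?mulNr ?(morph_addN young_extD) young_extM.
Qed.
End YoungGroup.

(** * Generators of the induced module *)

Lemma gr_scale_elt (gT : finGroupType) (V : zmodType) (act : gT -> V -> V) g v :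
  gr_scale act (gr_elt g) v = act g v.
Proof.
rewrite /gr_scale (bigD1 g) //= ffunE eqxx mulr1z big1 ?addr0 // => h /negPf hg.
by rewrite ffunE hg mulr0z.
Qed.

Lemma trivial_scale_elt (gT : finGroupType) (g : gT) (k : trivial_module gT) :
  gr_elt g *: k = k.
Proof. exact: gr_scale_elt. Qed.

Lemma outer_scale_elt (gT hT : finGroupType) (M : lmodType (group_ring gT))
    (N : lmodType (group_ring hT)) p (o : outer_tensor M N) :
  gr_elt p *: o = outer_act p o.
Proof. exact: gr_scale_elt. Qed.

Lemma outer_scale_tens (gT hT : finGroupType) (M : lmodType (group_ring gT))
    p (u : M) (k : trivial_module hT) :
  gr_elt p *: (tens _ _ u k : outer_tensor M (trivial_module hT))
    = tens _ _ (gr_elt p.1 *: u) k.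
Proof. by rewrite outer_scale_elt outer_actE trivial_scale_elt. Qed.

Section InducedSpecht.
Variables (t n m : nat) (lt_tn : (t < n)%N).
Variables (la : intpart t) (T : tableau la).
Let le_tn := ltnW lt_tn.
Local Notation e := (young_perm le_tn).
Local Notation M := (mod_mult (specht T) m).
Local Notation Triv := (trivial_module 'S_(n - t)).
Local Notation O := (outer_tensor M Triv).
Local Notation Ind := (induced_from_young le_tn M).
Local Notation GR := (group_ring 'S_n).
Implicit Types (x y : GR).

Definition outer_gen : O := tens _ _ (specht_cls T m 1) (1 : Triv).
(** The induced module is cyclic; this is the surjection from the group ring onto
it. *)
Definition ind_gen y : Ind := tens _ _ y outer_gen.

Lemma ind_genD x y : ind_gen (x + y) = ind_gen x + ind_gen y.
Proof. exact: tensDl. Qed.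
Lemma ind_genZ x y : x *: ind_gen y = ind_gen (x * y).
Proof. exact: induced_scaleE. Qed.
Lemma ind_gen_balanced x r :
  ind_gen (x * gr_map e r) = tens _ _ x (r *: outer_gen) :> Ind.
Proof. exact: tens_balanced. Qed.

Definition otens (u : M) (k : Triv) : O := tens _ _ u k.

Lemma outer_scale_gen p : gr_elt p *: outer_gen = otens (specht_cls T m (gr_elt p.1)) 1.
Proof.
by rewrite -[gr_elt p.1]mulr1 -specht_clsZ; exact: outer_scale_tens.
Qed.

(** The second factor acts trivially on the generator, so only the sums over it
matter. *)
Definition left_marginal (r : group_ring ('S_t * 'S_(n - t))%type) : group_ring 'S_t :=
  [ffun s => \sum_u r (s, u)].

Lemma outer_scaleE (r : group_ring ('S_t * 'S_(n - t))%type) :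
  r *: outer_gen = otens (specht_cls T m (left_marginal r)) 1.
Proof.
rewrite (@additive_gr_sum _ _ (fun z => otens (specht_cls T m z) 1)); last first.
  by move=> y z; rewrite specht_clsD; exact: tensDl.
rewrite (@additive_gr_sum _ _ (fun r => r *: outer_gen)); last first.
  by move=> y z; rewrite scalerDl.
rewrite (eq_bigr (fun p => gr_elt (p.1, p.2) *: outer_gen *~ r (p.1, p.2))) => [|[]//].
rewrite -(pair_bigA _ (fun s u => gr_elt (s, u) *: outer_gen *~ r (s, u))) /=.
apply: eq_bigr => s _; rewrite ffunE mulrz_sumr; apply: eq_bigr => u _.
by rewrite outer_scale_gen.
Qed.

Lemma outer_gen_surj o : exists r, o = r *: outer_gen.
Proof.
move: o; apply: tensor_ind => [_ _ [r ->] [r' ->]|u k].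
  by exists (r - r'); rewrite scalerBl.
have [z ->] := specht_cls_surj u.
exists [ffun p => if p.2 == 1%g then (z *~ k) p.1 else 0].
rewrite outer_scaleE (_ : left_marginal _ = z *~ k); last first.
  apply/ffunP => s; rewrite ffunE (bigD1 1%g) //= ffunE eqxx big1 ?addr0 //.
  by move=> v /negPf v1; rewrite ffunE /= v1.
rewrite (morph_addMz (@specht_clsD _ _ T m)).
rewrite /otens tens_balanced; congr (tens _ _ _ _).
by rewrite intz.
Qed.

Lemma ind_gen_surj v : exists y, v = ind_gen y.
Proof.
move: v; apply: tensor_ind => [_ _ [y ->] [y' ->]|x o].
  exists (y - y'); rewrite (morph_addB ind_genD) //.
have [r ->] := outer_gen_surj o.
by exists (x * gr_map e r); rewrite ind_gen_balanced.
Qed.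

Lemma ind_genM_eq0 y : ind_gen (y *+ m) = 0.
Proof.
have -> : ind_gen (y *+ m) = ind_gen y *+ m by rewrite (morph_addMn ind_genD).
have -> : ind_gen y *+ m = tens _ _ y (outer_gen *+ m).
  exact/esym/(morph_addMn (fun a b => tensDr _ _ y a b)).
have -> : outer_gen *+ m = otens (specht_cls T m 1 *+ m) 1.
  exact/esym/(@morph_addMn _ _ (fun u => otens u 1) (fun a b => tensDl _ _ a b _)).
rewrite -(morph_addMn (@specht_clsD _ _ T m)).
rewrite (_ : specht_cls T m (1 *+ m) = 0); last first.
  by apply/specht_cls_eq0; exists 1.
have -> : otens 0 1 = 0.
  exact: (@morph_add0 _ _ (fun u => otens u 1) (fun a b => tensDl _ _ a b _)).
exact: (morph_add0 (fun a b => tensDr _ _ y a b)).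
Qed.

Lemma outer_gen_ann (r : group_ring ('S_t * 'S_(n - t))%type) :
  left_marginal r * col_sum T * row_sum T = 0 ->
  r *: outer_gen = 0.
Proof.
move=> r0; rewrite outer_scaleE (_ : specht_cls T m _ = 0).
  exact: (@morph_add0 _ _ (fun u => otens u 1) (fun a b => tensDl _ _ a b _)).
by apply/specht_cls_eq0; exists 0; rewrite r0 mul0rn !mul0r.
Qed.

(** Over each coset c of the Young subgroup, y is the translate by c of an element
of its group ring.  The translates of [young_ext] have disjoint supports, so
each of these elements annihilates the Specht generator. *)
Lemma ind_gen_ann y : y * young_ext lt_tn (col_sum T * row_sum T) = 0 ->
  ind_gen y = 0.
Proof.
move=> y0; rewrite (additive_gr_sum _ ind_genD).
rewrite (eq_bigl (fun g => g \in [set: 'S_n])) => [|g]; last by rewrite inE.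
rewrite (@sum_lcosets _ _ (young_group_group lt_tn) (setT_group _)) ?subsetT //.
apply: big1 => C _; rewrite (sum_young lt_tn); move: (fingroup.repr C) => c.
pose r : group_ring ('S_t * 'S_(n - t))%type := [ffun p => y (c * e p)%g].
have re : \sum_p ind_gen (gr_elt (c * e p)%g) *~ y (c * e p)%g
    = tens _ _ (gr_elt c) (r *: outer_gen) :> Ind.
  rewrite -ind_gen_balanced /gr_map mulr_sumr.
  rewrite (big_morph ind_gen ind_genD (morph_add0 ind_genD)).
  apply: eq_bigr => p _; rewrite mulrzAr (morph_addMz ind_genD) -gr_eltM.
  by rewrite ffunE.
rewrite [LHS]re outer_gen_ann; first exact: (morph_add0 (fun a b => tensDr _ _ _ a b)).
rewrite -mulrA; apply/ffunP => s; rewrite gr_mulE [RHS]ffunE.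
have /ffunP/(_ (c * e (s, 1))%g) := y0; rewrite gr_mulE [RHS]ffunE => y0c.
rewrite -[RHS]y0c [RHS](reindex_inj (mulgI c)) /=.
rewrite [RHS](bigID (mem (young_group lt_tn))) /= [X in _ = _ + X]big1 ?addr0; last first.
  move=> g gE; rewrite (young_ext_out (lt_tn := lt_tn)) ?mulr0 //.
  rewrite invMg -mulgA mulKg (groupMr (G := young_group_group lt_tn)) ?groupV //.
  by apply/young_groupP; exists (s, 1%g).
rewrite (sum_young lt_tn
  (fun g => y (c * g)%g * young_ext lt_tn _ ((c * g)^-1 * (c * e (s, 1)))%g)).
pose F s' u := y (c * e (s', u))%g * (col_sum T * row_sum T) (s'^-1 * s)%g.
rewrite (eq_bigr (fun p => F p.1 p.2)); last first.
  move=> [s' u] _; congr (_ * _).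
  by rewrite invMg -mulgA mulKg -young_permV -young_permM young_extE.
rewrite -(pair_bigA _ F) /=; apply: eq_bigr => s' _.
by rewrite ffunE mulr_suml; apply: eq_bigr => u _; rewrite ffunE.
Qed.
End InducedSpecht.

(** * Vanishing in the induced module modulo m *)

Section Reduction.
Variables (R : pzRingType) (V : lmodType R) (m : nat).
Definition red (x : V) : mod_mult V m := \pi_(mod_mult V m) x.

Lemma red_eq x y : red x = red y <-> exists z, x - y = z *+ m.
Proof.
split=> [/quotmod_eqP/asboolP//|H].
by apply/quotmod_eqP/asboolP.
Qed.
Lemma redD : {morph red : x y / x + y}.
Proof. by move=> x y; exact: quotmod_piD. Qed.
Lemma redZ a x : a *: red x = red (a *: x).
Proof. exact: quotmod_piZ. Qed.
Lemma red_surj v : exists x, v = red x.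
Proof. by elim/quotW: v => x; exists x. Qed.
Lemma red_repr x : exists z, repr (red x) = x + z *+ m.
Proof.
have /red_eq[z e] : red (repr (red x)) = red x by rewrite /red reprK.
by exists z; rewrite -e addrCA subrr addr0.
Qed.
End Reduction.

Section Detection.
Variables (t n m : nat) (lt_tn : (t < n)%N).
Variables (la : intpart t) (T : tableau la).
Let le_tn := ltnW lt_tn.
Local Notation e := (young_perm le_tn).
Local Notation M := (mod_mult (specht T) m).
Local Notation Triv := (trivial_module 'S_(n - t)).
Local Notation O := (outer_tensor M Triv).
Local Notation Ind := (induced_from_young le_tn M).
Local Notation GR := (group_ring 'S_n).
Local Notation Q := (mod_mult ((GR)^o : lmodType GR) m).
Implicit Types (x y : GR).

Definition spval (v : M) : GR := young_ext lt_tn (submod_val (repr v)).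

(** The map from the Specht module modulo m to the group ring modulo m, extended
below to the induced module in order to detect which [ind_gen y] can vanish. *)
Definition specht_emb (v : M) : Q := red m (spval v : GR^o).

Lemma specht_embE (s : specht T) :
  specht_emb (red m s) = red m (young_ext lt_tn (submod_val s) : GR^o).
Proof.
have [s' es] := red_repr m s.
apply/red_eq; exists (young_ext lt_tn (submod_val s')).
have valD (u u' : specht T) : submod_val (u + u') = submod_val u + submod_val u' by [].
rewrite /spval es valD specht_valMn (young_extD lt_tn) (morph_addMn (young_extD lt_tn)).
by rewrite addrAC subrr add0r.
Qed.

Lemma specht_embD : {morph specht_emb : u v / u + v}.
Proof.
move=> u v; have [s ->] := red_surj u; have [s' ->] := red_surj v.
rewrite -redD !specht_embE -redD; congr (red _ _).
exact: young_extD.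
Qed.

Lemma specht_emb_elt p v :
  specht_emb (gr_elt p.1 *: v) = gr_elt (e p) *: specht_emb v.
Proof.
have [s ->] := red_surj v; rewrite redZ !specht_embE redZ; congr (red _ _).
exact/esym/young_extM.
Qed.

Definition outer_emb : O -> Q := tensor_lift (fun v (k : int) => specht_emb v *~ k).

Let emb_balanced u (k : int) (k' : Triv) :
  specht_emb (u *~ k) *~ k' = specht_emb u *~ (k' *~ k).
Proof.
rewrite (morph_addMz specht_embD) -mulrzA mulrC; congr (_ *~ _).
exact/esym/mulrzz.
Qed.
Lemma outer_embD : {morph outer_emb : o o' / o + o'}.
Proof.
apply: tensor_liftD => [u u' k|u k k'|u k k'].
- by rewrite specht_embD mulrzDl.
- by rewrite mulrzDr.
exact: emb_balanced.
Qed.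

Lemma outer_embE u k : outer_emb (tens _ _ u k) = specht_emb u *~ k.
Proof.
apply: tensor_liftE => [v v' {}k|v {}k k'|v {}k k'].
- by rewrite specht_embD mulrzDl.
- by rewrite mulrzDr.
exact: emb_balanced.
Qed.

Lemma outer_emb_act p o : outer_emb (outer_act p o) = gr_elt (e p) *: outer_emb o.
Proof.
move: o; apply: (tensor_eq (f := fun o => outer_emb (outer_act p o))
                           (g := fun o => gr_elt (e p) *: outer_emb o)).
- by move=> x y; rewrite outer_actD outer_embD.
- by move=> x y; rewrite outer_embD scalerDr.
move=> u k; rewrite outer_actE !outer_embE trivial_scale_elt specht_emb_elt.
exact/esym/(raddfMz ( *:%R (gr_elt (e p)))).
Qed.

Lemma outer_embZ r o : outer_emb (r *: o) = gr_map e r *: outer_emb o.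
Proof.
rewrite -[r *: o]/(gr_scale (@outer_act _ _ M Triv) r o) /gr_scale.
rewrite (big_morph outer_emb outer_embD (morph_add0 outer_embD)).
rewrite /gr_map scaler_suml; apply: eq_bigr => p _.
rewrite (morph_addMz outer_embD) outer_emb_act.
exact/esym/(morph_addMz (fun a b => scalerDl (outer_emb o) a b)).
Qed.

Definition ind_emb : Ind -> Q := tensor_lift (fun (x : GR) o => x *: outer_emb o).

Lemma ind_emb_gen y :
  ind_emb (ind_gen m lt_tn T y)
    = red m (y * young_ext lt_tn (col_sum T * row_sum T) : GR^o).
Proof.
rewrite /ind_emb /ind_gen tensor_liftE => [|a a' b|a b b'|a r b].
- rewrite /outer_gen outer_embE mulr1z -[specht_cls _ _ _]/(red m _) specht_embE redZ.
  by congr (red m _); rewrite /= mul1r.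
- by rewrite scalerDl.
- by rewrite outer_embD scalerDr.
by rewrite outer_embZ scalerA.
Qed.

Lemma ind_emb0 : ind_emb 0 = 0.
Proof.
have <- : ind_gen m lt_tn T 0 = 0 by apply: (morph_add0 (@ind_genD _ _ _ _ _ _)).
by rewrite ind_emb_gen mul0r; apply: (morph_add0 (@redD _ _ _)).
Qed.

Lemma ind_gen_eq0 y : ind_gen m lt_tn T y = 0 ->
  exists z, y * young_ext lt_tn (col_sum T * row_sum T) = z *+ m.
Proof.
move=> y0; have := ind_emb0; rewrite -y0 ind_emb_gen => e0.
have /red_eq[z e1] :
    red m (y * young_ext lt_tn (col_sum T * row_sum T) : GR^o) = red m 0.
  by rewrite e0; apply/esym/(morph_add0 (@redD _ _ _)).
by exists z; rewrite -e1 subr0.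
Qed.

Lemma ind_word_coef y g :
  (y * young_ext lt_tn (col_sum T * row_sum T)) g
    = wcomb (y * colsum (kap0 lt_tn T)) (rho0 lt_tn T) (wact g (rho0 lt_tn T)).
Proof. by rewrite -young_ext_specht mulrA wcomb_rowsum. Qed.

Lemma ind_gen_dvd y w : ind_gen m lt_tn T y = 0 ->
  exists k, wcomb (y * colsum (kap0 lt_tn T)) (rho0 lt_tn T) w = k *+ m.
Proof.
move=> /ind_gen_eq0[z zE].
have [->|/wcomb_orbit[g ->]] :=
  eqVneq (wcomb (y * colsum (kap0 lt_tn T)) (rho0 lt_tn T) w) 0.
  by exists 0; rewrite mul0rn.
by exists (z g); rewrite -ind_word_coef zE ffunMnE.
Qed.

Lemma ind_gen_word0 y :
  (forall w, wcomb (y * colsum (kap0 lt_tn T)) (rho0 lt_tn T) w = 0) ->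
  ind_gen m lt_tn T y = 0.
Proof.
move=> y0; apply: ind_gen_ann; apply/ffunP => g.
by rewrite ind_word_coef y0 ffunE.
Qed.
End Detection.

End Modules.

(** * The filtration *)

Lemma eq_intpart n (mu nu : intpart n) : part mu =1 part nu -> mu = nu.
Proof.
move=> e; apply: val_inj => /=.
have le (a b : intpart n) : part a =1 part b -> (size a <= size b)%N.
  move=> ab; rewrite leqNgt; apply/negP => lt; have /and3P[_ nz _] := valP a.
  case/negP: nz; rewrite -(nth_default 0%N (leqnn (size b))) -/(part b _) -ab.
  exact: mem_nth.
apply: (@eq_from_nth _ 0%N) => [|i _]; last exact: e.
by apply/eqP; rewrite eqn_leq !le // => i; rewrite e.
Qed.

Lemma intparts_finite n : exists s : seq (intpart n), forall nu, nu \in s.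
Proof.
pose s := [seq map val u | u <- flatten
  [seq map (@tval k 'I_n.+1) (enum {: k.-tuple 'I_n.+1}) | k <- iota 0 n.+1]].
exists (pmap insub s) => nu; rewrite mem_pmap_sub.
have bound a : a \in val nu -> (a < n.+1)%N.
  have /and3P[_ _ /eqP sz] := valP nu; rewrite -[X in (_ < X.+1)%N]sz ltnS.
  elim: (val nu) => //= b r IHr; rewrite inE => /orP[/eqP->|/IHr]; lia.
apply/mapP; exists (map (@inord n) (val nu)); last first.
  rewrite -map_comp -[LHS]map_id; apply/eq_in_map => a /bound an.
  by rewrite /= inordK.
apply/flattenP.
exists (map (@tval (size nu) 'I_n.+1) (enum {: (size nu).-tuple 'I_n.+1})).
  by apply/mapP; exists (size nu) => //; rewrite mem_iota add0n ltnS intpart_size.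
have sz : size (map (@inord n) (val nu)) == size nu by rewrite size_map.
by apply/mapP; exists (Tuple sz); rewrite ?mem_enum.
Qed.

Section Filtration.
Local Open Scope ring_scope.
Local Open Scope quotient_scope.
Variables (t n m : nat) (lt_tn : (t < n)%N).
Variables (la : intpart t) (T : tableau la).
Local Notation word := (word n).
Local Notation GR := (group_ring 'S_n).
Local Notation M := (mod_mult (specht T) m).
Local Notation Ind := (induced_from_young (ltnW lt_tn) M).
Local Notation gen := (ind_gen m lt_tn T).
Implicit Types (x y z : GR) (w u : word) (mu nu : intpart n).

Definition ind_comb y : word -> int := wcomb (y * colsum (kap0 lt_tn T)) (rho0 lt_tn T).

Lemma ind_comb_occ y w i : ind_comb y w != 0 -> (i < n)%N -> occ w i = part la i.
Proof. by move=> /occ_wcomb -> lt_in; exact: occ_rho0. Qed.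
Lemma ind_comb_infty y w : ind_comb y w != 0 -> occ w n = (n - t)%N.
Proof.
move=> /occ_wcomb ->; rewrite -[RHS]card_ord -(card_codom (@rpos_inj _ _ lt_tn)).
apply: eq_card => a; rewrite inE; apply/idP/codomP => [/rho0_infty//|[k ->]].
by rewrite extend_rpos.
Qed.
Lemma ind_comb_bound y w : ind_comb y w != 0 -> forall a, (w a <= n)%N.
Proof.
move=> /wcomb_orbit[g ->] a; rewrite ffunE; case: (posP lt_tn (g a)) => j.
  rewrite extend_lpos; have := content_bound (nu := la) j (has_content_wact T 1).
  by rewrite wact1; lia.
by rewrite extend_rpos.
Qed.

Definition ind_spread y w := spread (ind_comb y) w.
Lemma ind_spreadD x y w : ind_spread (x + y) w = ind_spread x w + ind_spread y w.
Proof. by rewrite -big_split; apply: eq_bigr => X _; rewrite /ind_comb mulrDl wcombD. Qed.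
Lemma ind_spreadB x y w : ind_spread (x - y) w = ind_spread x w - ind_spread y w.
Proof. exact: (morph_addB (fun a b => ind_spreadD a b w)). Qed.
Lemma ind_spreadMn x k w : ind_spread (x *+ k) w = ind_spread x w *+ k.
Proof. exact: (morph_addMn (fun a b => ind_spreadD a b w)). Qed.
Lemma ind_spreadM x y w :
  ind_spread (x * y) w = \sum_g x g * ind_spread y (wact g^-1 w).
Proof.
rewrite /ind_spread (eq_spread
  (f' := wcomb (x * (y * colsum (kap0 lt_tn T))) (rho0 lt_tn T))).
  exact: spread_wcombM.
by move=> v; rewrite /ind_comb mulrA.
Qed.

Lemma has_content_act g mu w : has_content mu w -> has_content mu (wact g w).
Proof. by move=> wmu i; rewrite occ_wact. Qed.

Definition killed (s : seq (intpart n)) y :=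
  forall mu, mu \in s -> forall w, has_content mu w -> ind_spread y w = 0.

Lemma killed0 s : killed s 0.
Proof. by move=> mu _ w _; apply: (morph_add0 (fun a b => ind_spreadD a b w)). Qed.
Lemma killed_lin s a x y : killed s x -> killed s y -> killed s (a * x + y).
Proof.
move=> kx ky mu mus w wmu; rewrite ind_spreadD (ky mu) // addr0 ind_spreadM.
by apply: big1 => g _; rewrite (kx mu) ?mulr0 //; apply: has_content_act.
Qed.

Definition layer s : {pred Ind} := fun v => `[< exists2 y, v = gen y & killed s y >].
Fact layer_closed s : submod_closed (layer s).
Proof.
split=> [|a v v' /asboolP[y -> ky] /asboolP[y' -> ky']]; apply/asboolP.
  by exists 0; [rewrite (morph_add0 (@ind_genD _ _ _ _ _ _)) | apply: killed0].
exists (a * y + y'); last exact: killed_lin.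
by rewrite ind_genD ind_genZ.
Qed.
HB.instance Definition _ s :=
  GRing.isSubmodClosed.Build _ Ind (layer s) (layer_closed s).

Lemma layer_nil v : v \in layer [::].
Proof. by have [y ->] := ind_gen_surj v; apply/asboolP; exists y. Qed.

(** If all interlacing contents are killed, then the function on words attached to
a representative is zero, and with it the vector. *)
Lemma layer_all s v : (forall mu, interlacing la mu -> mu \in s) ->
  v \in layer s <-> v = 0.
Proof.
move=> all; split=> [/asboolP[y -> ky]|->]; last exact: rpred0.
apply: ind_gen_word0; apply: (@spread_injective _ _ lt_tn la (ind_comb y)).
- move=> i lt_in; exact: rho0_two_row.
- by move=> v' i; apply: ind_comb_occ.
- exact: ind_comb_infty.
- exact: ind_comb_bound.
by move=> mu /all mus w; apply: ky.
Qed.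

Section Step.
Variables (nu : intpart n) (Tn : tableau nu) (s : seq (intpart n)).
Hypothesis nu_int : interlacing la nu.
Hypothesis s_low : forall mu, mu \in s ->
  mu <> nu /\ (content_height mu <= content_height nu)%N.
Hypothesis s_all : forall mu, interlacing la mu ->
  (content_height mu < content_height nu)%N -> mu \in s.

Local Notation spw z := (wcomb (z * colsum (colword Tn)) (rowword Tn)).

Lemma spw_content z w : spw z w != 0 -> has_content nu w.
Proof. by case/wcomb_orbit => g ->; apply: has_content_wact. Qed.

Lemma killed_james_kernel y : killed s y ->
  james_kernel (fun w => if `[< has_content nu w >] then ind_spread y w else 0).
Proof.
move=> ky; apply: (@spread_james_kernel _ _ lt_tn la (ind_comb y)) => //.
- move=> i lt_in; exact: rho0_two_row.
- by move=> v' i; apply: ind_comb_occ.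
by move=> mu mui /(s_all mui) mus w; apply: ky.
Qed.

(** Division by m stays in the kernel, since the integers have no torsion; this is
the purity of the Specht module in the tabloid module. *)
Lemma james_kernel_dvd (F : word -> int) : (forall w, F w != 0 -> has_content nu w) ->
  james_kernel F -> (forall w, exists k, F w = k *+ m) ->
  exists z, forall w, F w = spw (z *+ m) w.
Proof.
move=> Fc F0 Fm; have [m0|m_gt0] := posnP m.
  exists 0 => w; rewrite mul0rn mul0r wcomb0.
  by have [k ->] := Fm w; rewrite m0 mulr0n.
have [G GE] := choice Fm.
have mI : injective (fun k : int => k *+ m) by apply: Num.Theory.pmulrnI.
have [|i Z w j lt_in wZ j0|z zE] := @james_kernel_polytabloids _ _ Tn G.
- move=> w Gw; apply: Fc; rewrite GE; apply: contra Gw => /eqP e.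
  by apply/eqP/mI; rewrite e mul0rn.
- apply: mI; rewrite /= mul0rn -sumrMnl -[RHS](F0 i Z w j lt_in wZ j0).
  by apply: eq_bigr => Y _; rewrite GE.
by exists z => w; rewrite GE zE mulrnAl wcombMn.
Qed.

Lemma killed_specht y : killed s y ->
  exists z, forall w, has_content nu w -> ind_spread y w = spw z w.
Proof.
move=> ky; have [w|z zE] := james_kernel_polytabloids Tn _ (killed_james_kernel ky).
  by case: asboolP.
by exists z => w wnu; rewrite -zE; case: asboolP.
Qed.

(** The horizontal strip element realizes the polytabloid of nu, and equivariance
gives all other elements. *)
Lemma specht_killed z : exists2 y, killed s y &
  forall w, has_content nu w -> ind_spread y w = spw z w.
Proof.
have [y1 y1E] := horizontal_comb lt_tn T Tn (interlacing_le lt_tn nu_int).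
have bound mu w : has_content mu w -> (content_height mu <= content_height nu)%N ->
    ind_spread y1 w = spw 1 w.
  move=> wmu hmu; rewrite /ind_spread /ind_comb -y1E mul1r.
  have hT : height (rowword Tn) = content_height nu.
    by apply: height_content => i; rewrite occ_rowword.
  apply: (spread_horizontal (interlacing_ge lt_tn nu_int)).
    by move=> a; apply: content_bound wmu.
  by rewrite hT (height_content wmu).
exists (z * y1) => [mu mus w wmu|w wnu]; rewrite ind_spreadM.
  have [neq hmu] := s_low mus; apply: big1 => g _.
  rewrite (bound mu) //; last exact: has_content_act.
  have [->|/spw_content c] := eqVneq (spw 1 (wact g^-1 w)) 0; first by rewrite mulr0.
  by case: neq; apply: eq_intpart => i; rewrite -c occ_wact wmu.
rewrite -[z in RHS]mulr1 -mulrA wcombM; apply: eq_bigr => g _.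
by rewrite (bound nu) //; apply: has_content_act.
Qed.

Lemma specht_cls_dvd z : (forall w, has_content nu w -> exists k, spw z w = k *+ m) ->
  specht_cls Tn m z = 0.
Proof.
move=> zm; apply/specht_cls_eq0.
have [w|||z' z'E] := james_kernel_dvd (F := spw z).
- exact: spw_content.
- exact: polytabloid_james_kernel.
- move=> w; have [->|/spw_content/zm//] := eqVneq (spw z w) 0.
  by exists 0; rewrite mul0rn.
exists z'; rewrite row_sumE col_sumE; apply/ffunP => g.
by rewrite !wcomb_rowsum z'E.
Qed.

Lemma specht_cls0_dvd z w : specht_cls Tn m z = 0 -> exists k, spw z w = k *+ m.
Proof.
move=> /specht_cls_eq0[z']; rewrite row_sumE col_sumE => e.
have [->|/wcomb_orbit[g ->]] := eqVneq (spw z w) 0; first by exists 0; rewrite mul0rn.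
exists (spw z' (wact g (rowword Tn))).
by rewrite -wcombMn -mulrnAl -!wcomb_rowsum e.
Qed.

Lemma killed_cons y : killed s y ->
  (forall w, has_content nu w -> ind_spread y w = 0) -> killed (nu :: s) y.
Proof. by move=> ky y0 mu /[!inE] /orP[/eqP-> //|]; apply: ky. Qed.

(** An image divisible by m is m times another element of the Specht module, which
is itself the image of some y'; subtracting m y' does not change the class in
the induced module. *)
Lemma killed_dvd y : killed s y ->
  (forall w, has_content nu w -> exists k, ind_spread y w = k *+ m) ->
  exists y', killed (nu :: s) (y - y' *+ m).
Proof.
move=> ky ym.
have [w|w|z zE] := james_kernel_dvd _ (killed_james_kernel ky).
- by case: asboolP.
- by case: asboolP => [/ym//|_]; exists 0; rewrite mul0rn.
have [y' ky' y'E] := specht_killed z; exists y'; apply: killed_cons.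
  move=> mu mus w wmu; rewrite ind_spreadB ind_spreadMn (ky mu) // (ky' mu) //.
  by rewrite mul0rn subrr.
move=> w wnu; rewrite ind_spreadB ind_spreadMn y'E //.
have := zE w; case: asboolP => // _ ->.
by rewrite mulrnAl wcombMn subrr.
Qed.

Lemma gen_eq_dvd y y' w : gen y = gen y' ->
  exists k, ind_spread y w - ind_spread y' w = k *+ m.
Proof.
move=> e; have e0 : gen (y - y') = 0.
  by rewrite (morph_addB (@ind_genD _ _ _ _ _ _)) e subrr.
have [k kE] := choice (fun v => ind_gen_dvd v e0).
exists (\sum_(X : {set 'I_n}) k (blank X w)); rewrite -ind_spreadB -sumrMnl.
by apply: eq_bigr => X _; rewrite -kE.
Qed.

(** A class of the subquotient is related to a Specht class if representatives have
the same image modulo m among the functions on the words of content nu. *)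
Lemma layer_factor :
  isomorphic (subquotient (layer (nu :: s)) (layer s)) (mod_mult (specht Tn) m).
Proof.
pose sq := subquotient (layer (nu :: s)) (layer s).
pose cls (v : submod (layer s)) : sq :=
  \pi_(quotmod (restr_pred (layer (nu :: s)) (W := layer s))) v.
have cls0 : cls 0 = 0 by apply: (morph_add0 (@quotmod_piD _ _ _)).
pose r (v : sq) (w : mod_mult (specht Tn) m) := exists y z (u : submod (layer s)),
  [/\ v = cls u /\ submod_val u = gen y, killed s y, w = specht_cls Tn m z &
      forall w, has_content nu w -> exists k, ind_spread y w - spw z w = k *+ m].
apply: (@isomorphic_of_rel _ _ _ r).
- elim/quotW => -[v vP]; have /asboolP[y vy ky] := vP.
  have [z zE] := killed_specht ky; exists (specht_cls Tn m z).
  exists y, z, (Submod vP); split=> // w wnu; exists 0.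
  by rewrite zE // subrr mul0rn.
- move=> w; have [z ->] := specht_cls_surj w; have [y ky yE] := specht_killed z.
  have vP : gen y \in layer s by apply/asboolP; exists y.
  exists (cls (Submod vP)), y, z, (Submod vP); split=> // u unu; exists 0.
  by rewrite yE // subrr mul0rn.
- move=> a v v' w w' [y [z [u [[-> uy] ky -> yz]]]] [y' [z' [u' [[-> uy'] ky' -> yz']]]].
  exists (a * y + y'), (a * z + z'), (a *: u + u'); split.
  + split; last by rewrite /= uy uy' ind_genZ ind_genD.
    by rewrite /cls quotmod_piD -quotmod_piZ.
  + exact: killed_lin.
  + by rewrite specht_clsD specht_clsZ.
  move=> c cnu; have [k' kE'] := yz' c cnu.
  have /choice[k kE] : forall g : 'S_n, exists k,
      ind_spread y (wact g^-1 c) - spw z (wact g^-1 c) = k *+ m.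
    by move=> g; apply: yz; apply: has_content_act.
  exists (\sum_g a g * k g + k'); rewrite mulrnDl -kE' -sumrMnl.
  rewrite ind_spreadD mulrDl wcombD ind_spreadM -mulrA wcombM.
  rewrite opprD addrACA -sumrB; congr (_ + _); apply: eq_bigr => g _.
  by rewrite -mulrBr kE mulrnAr.
(* Two elements with the same class have congruent images modulo m, not equal
   ones. *)
- move=> w [y [z [u [[u0 uy] ky -> yz]]]]; apply: specht_cls_dvd => c cnu.
  have : u - 0 \in restr_pred (layer (nu :: s)) (W := layer s).
    by apply/quotmod_eqP; rewrite -[LHS]/(cls u) -u0 -[RHS]/(cls 0) cls0.
  rewrite subr0 => /asboolP[y0]; rewrite uy => e ky0.
  have [k kE] := gen_eq_dvd c e; have [k' kE'] := yz c cnu.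
  exists (k - k'); rewrite mulrnBl -kE -kE' (ky0 nu) ?inE ?eqxx //.
  by rewrite subr0 opprB addrC subrK.
(* The image of y is only known to be divisible by m; y is corrected by a
   multiple of m, which does not change its class. *)
move=> v [y [z [u [[-> uy] ky z0 yz]]]].
have [|y' ky'] := killed_dvd ky.
  move=> c cnu; have [k kE] := yz c cnu; have [k' kE'] := specht_cls0_dvd c (esym z0).
  by exists (k + k'); rewrite mulrnDl -kE -kE' subrK.
rewrite -cls0; apply/quotmod_eqP.
rewrite subr0; apply/asboolP; exists (y - y' *+ m) => //.
by rewrite (morph_addB (@ind_genD _ _ _ _ _ _)) ind_genM_eq0 subr0.
Qed.
End Step.
End Filtration.

(** * The series *)

Theorem theorem4 (t n m : nat) (t_gt0 : 0 < t) (lt_tn : t < n)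
    (la : intpart t) (T : tableau la)
    (Tnu : forall nu : intpart n, tableau nu) :
  exists nus : seq (intpart n),
    [/\ uniq nus,
        forall nu : intpart n, (nu \in nus) = interlacing la nu
      & has_series
          (induced_from_young (ltnW lt_tn) (mod_mult (specht T) m))
          [seq mod_mult (specht (Tnu nu)) m | nu <- nus]].
Proof.
have [s sP] := intparts_finite n.
pose lower (mu nu : intpart n) := content_height nu <= content_height mu.
(* The largest heights come first, since the first steps of the series are those
   killed at the most contents. *)
pose nus := sort lower (undup (filter (interlacing la) s)).
have lowT : transitive lower by move=> b a c /= ab bc; apply: leq_trans bc ab.
have nus_in nu : (nu \in nus) = interlacing la nu.
  by rewrite mem_sort mem_undup mem_filter sP andbT.
have nus_uniq : uniq nus by rewrite sort_uniq undup_uniq.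
have nus_sorted : pairwise lower nus.
  by rewrite -(sorted_pairwise lowT) sort_sorted // => a b; apply: leq_total.
exists nus; split=> //.
exists (fun i => @layer t n m lt_tn la T (drop i nus) : submodClosed _); split.
- move=> x; apply: layer_all => mu; by rewrite drop0 nus_in.
- by move=> x; rewrite size_map drop_size; apply: layer_nil.
move=> i; rewrite size_map => i_lt.
have nu0 : intpart n by case: (nus) i_lt => [//|nu0 _ _]; exact: nu0.
rewrite (nth_map nu0) //; set nu := nth nu0 nus i.
have drop_i : drop i nus = nu :: drop i.+1 nus by rewrite -drop_nth.
have nus_i : nus = take i nus ++ nu :: drop i.+1 nus by rewrite -drop_i cat_take_drop.
split.
  move=> x /asboolP[y -> ky]; apply/asboolP; exists y => // mu mus.
  by apply: ky; rewrite drop_i inE mus orbT.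
rewrite drop_i; apply: layer_factor => [|mu mus|mu mui mu_nu].
- by rewrite -nus_in mem_nth.
- split=> [e|].
    move: nus_uniq; rewrite nus_i cat_uniq => /and3P[_ _] /=.
    by rewrite -e mus.
  move: nus_sorted; rewrite nus_i pairwise_cat => /and3P[_ _] /= /andP[/allP H _].
  exact: H.
have : mu \in take i nus ++ nu :: drop i.+1 nus by rewrite -nus_i nus_in.
rewrite mem_cat inE => /or3P[mu_take|/eqP e|//].
  move: nus_sorted; rewrite nus_i pairwise_cat => /and3P[/allrelP H _ _].
  by have := H mu nu mu_take (mem_head _ _); rewrite /lower leqNgt mu_nu.
by move: mu_nu; rewrite e ltnn.
Qed.
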